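(* Let $n\ge2$, $k\ge1$, let $M^n\hookrightarrow\tilde M^{n+k}$ be an embedded submanifold of a Riemannian manifold, $v$ a vector field on $M$, $p\in M$, with $v$ extended to a neighborhood of $p$ in $\tilde M$ (still denoted $v$). The following hold at $p$. (Bochner Laplacian) For general $k\ge1$, $$(\tilde\nabla^*\tilde\nabla v)^T=\nabla^*\nabla v+\sum_{l=1}^kW_{N_l}W_{N_l}v+n(\tilde\nabla_{\mathbf H}v)^T-\sum_{l=1}^k(\tilde\nabla_{N_l}\tilde\nabla_{N_l}v-\tilde\nabla_{\tilde\nabla_{N_l}N_l}v)^T,$$ and for a hypersurface ($k=1$), $$(\tilde\nabla^*\tilde\nabla v)^T=\nabla^*\nabla v+s^2v+nH(\tilde\nabla_Nv)^T-(\tilde\nabla_N\tilde\nabla_Nv)^T+\nabla_{\tilde\nabla_NN}v.$$ (Deformation Laplacian) With $\tilde Lv=-2\,\widetilde{\operatorname{div}}\,\widetilde{\operatorname{Def}}\,v$ and $Lv=-2\operatorname{div}\operatorname{Def}v$, for general $k\ge1$, $$(\tilde Lv)^T=Lv+n[\mathbf H,v]^T-\sum_{l=1}^k(\tilde\nabla_{N_l}\tilde\nabla_{N_l}v-\tilde\nabla_{\tilde\nabla_{N_l}N_l}v)^T-\sum_{l=1}^k\delta^{ij}\tilde R(N_l,E_i,v,N_l)E_j+\nabla\operatorname{div}^\perp v,$$ and for a hypersurface, $$(\tilde Lv)^T=Lv+nH[N,v]^T-\tilde\nabla_N\tilde\nabla_Nv+\nabla_{\tilde\nabla_NN}v-\delta^{ij}\tilde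 R(N,E_i,v,N)E_j+\nabla\operatorname{div}^\perp v.$$ (Divergence free case) If $\widetilde{\operatorname{div}}\,v=0=\operatorname{div}v$, then for general $k\ge1$, $$(\tilde\nabla^*\tilde\nabla v-\widetilde{\mathrm{Ric}}\,v)^T=\nabla^*\nabla v-\mathrm{Ric}\,v+n[\mathbf H,v]^T-\sum_{l=1}^k(\tilde\nabla_{N_l}\tilde\nabla_{N_l}v-\tilde\nabla_{\tilde\nabla_{N_l}N_l}v)^T-\sum_{l=1}^k\delta^{ij}\tilde R(N_l,E_i,v,N_l)E_j,$$ and for a hypersurface, $$(\tilde\nabla^*\tilde\nabla v-\widetilde{\mathrm{Ric}}\,v)^T=\nabla^*\nabla v-\mathrm{Ric}\,v+nH[N,v]-(\tilde\nabla_N\tilde\nabla_Nv)^T+\nabla_{\tilde\nabla_NN}v-\delta^{ij}\tilde R(N,E_i,v,N)E_j.$$ (Hodge Laplacian) For general $k\ge1$, $$(-\tilde\Delta_hv)^T=-\Delta_hv+2\sum_{l=1}^kW_{N_l}W_{N_l}v+n(\tilde\nabla_{\mathbf H}v)^T-nW_{\mathbf H}v-\sum_{l=1}^k(\tilde\nabla_{N_l}\tilde\nabla_{N_l}v-\tilde\nabla_{\tilde\nabla_{N_l}N_l}v)^T+\sum_{l=1}^k\delta^{ij}\tilde R(N_l,E_i,v,N_l)E_j,$$ and for a hypersurface, $$(-\tilde\Delta_hv)^T=-\Delta_hv+2s^2v+nH(\tilde\nabla_Nv)^T-nHsv-(\tilde\nabla_N\tilde\nabla_Nv)^T+\nabla_{\tilde\nabla_NN}v+\delta^{ij}\tilde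 R(N,E_i,v,N)E_j.$$
   Context: Everything is smooth. $M$ carries the induced metric $g$; $\tilde\nabla,\nabla$ are the Levi-Civita connections of $(\tilde M,\tilde g)$ and $(M,g)$ (and also denote gradients of functions). ${}^T,{}^\perp$ are orthogonal projections onto $T_pM$ and $(T_pM)^\perp$. Deformation tensor: $(\operatorname{Def}v)_{ij}=\frac12(\nabla_iv_j+\nabla_jv_i)$ on $M$, and $\operatorname{div}\operatorname{Def}v$ is the vector field obtained from $\nabla^i(\operatorname{Def}v)_{ij}$ by raising the index; $\widetilde{\operatorname{Def}}$ and $\widetilde{\operatorname{div}}\,\widetilde{\operatorname{Def}}$ are the same objects on $\tilde M$. Frames: $E_1,\dots,E_n$ is a local orthonormal (ON) frame on $M$ near $p$, $N_1,\dots,N_k$ a local ON frame of the normal bundle, extended so that together they form an ON frame $\{E_\alpha\}$ of $\tilde M$ in a neighborhood of $p$; for $k=1$, $N=N_1$ is a choice of unit normal and the $E_i$ at $p$ are eigenvectors of the shape operator. Indices $i,j$ run over $1,\dots,n$; repeated indices are summed. $\mathrm{II}(X,Y)=(\tilde\nabla_XY)^\perp$; for a normal field $\eta$, $g(W_\eta X,Y)=\tilde g(\eta,\mathrm{II}(X,Y))$, i.e. $W_\eta X=-(\tilde\nabla_X\eta)^T$; $\mathbf H=\frac1n\delta^{ij}\mathrm{II}(E_i,E_j)$ (extended to a neighborhood of $p$ in $[\mathbf H,v]$). For $k=1$: shape operator $s=W_N$, so $sX=-\tilde\nabla_XN$; $H=\frac1n\operatorname{tr}s$, $\mathbf H=HN$.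 For vector fields, $\operatorname{div}v=\sum_ig(\nabla_{E_i}v,E_i)$ on $M$, $\widetilde{\operatorname{div}}\,v=\sum_\alpha\tilde g(\tilde\nabla_{E_\alpha}v,E_\alpha)$ on $\tilde M$ (near $p$), and the orthogonal divergence on $M$ is $\operatorname{div}^\perp v=\sum_{l=1}^k\tilde g(\tilde\nabla_{N_l}v,N_l)$. Bochner Laplacian for a Levi-Civita connection $D$ and ON frame $\{F_a\}$: $D^*Dv=-\sum_a(D_{F_a}D_{F_a}v-D_{D_{F_a}F_a}v)$. Hodge Laplacian on vector fields: $-\Delta_hv=\big((dd^*+d^*d)v^\flat\big)^\sharp$ on $M$, similarly $-\tilde\Delta_h$ on $\tilde M$. Curvature convention (tilde for $\tilde M$): $R(X,Y)Z=\nabla_X\nabla_YZ-\nabla_Y\nabla_XZ-\nabla_{[X,Y]}Z$, $R(W,X,Y,Z)=g(R(W,X)Y,Z)$, $\mathrm{Ric}(X,Y)=\sum_aR(F_a,X,Y,F_a)$ over an ON frame, $\mathrm{Ric}\,v=\mathrm{Ric}(v,\cdot)^\sharp$.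
   Formalization: In both deformation Laplacian formulas the last term is −∇div^⊥v instead of +∇div^⊥v (the printed sign fails for v = x₁y∂_y in flat space), and in the hypersurface one the term ∇̃_N∇̃_N v is projected: (∇̃_N∇̃_N v)^T. *)

(* Defs.v *)
From mathcomp Require Import all_boot all_order all_algebra.
From mathcomp Require Import all_classical all_reals all_analysis.

Set Implicit Arguments.
Unset Strict Implicit.
Unset Printing Implicit Defensive.

Import Order.TTheory GRing.Theory Num.Theory.
Import numFieldNormedType.Exports.
Local Open Scope classical_set_scope.
Local Open Scope ring_scope.

(** * Smooth functions on open subsets of R^m *)

Section EuclideanSmoothness.
Variables (R : realType) (m : nat).

Fixpoint partials (s : seq 'I_m) (f : 'rV[R]_m -> R) : 'rV[R]_m -> R :=
  if s is i :: s' then 'D_(delta_mx 0 i) (partials s' f) else f.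

(* Meaningful for open U only: the partial derivatives are taken in R^m. *)
Definition smooth_euclid (U : set 'rV[R]_m) (f : 'rV[R]_m -> R) : Prop :=
  forall s x, U x ->
    {for x, continuous (partials s f)} /\
    (forall i, derivable (partials s f) x (delta_mx 0 i)).

End EuclideanSmoothness.

(** * Smooth manifolds *)

(* [cmap] and [cinv] are total functions; only their restrictions to [cdom]
   and to [cimg] are relevant. *)
Record chart (R : realType) (m : nat) (T : topologicalType) := Chart {
  cdom : set T;
  cmap : T -> 'rV[R]_m;
  cinv : 'rV[R]_m -> T }.

Definition cimg R m T (c : @chart R m T) : set 'rV[R]_m := cmap c @` cdom c.

Record manifold (R : realType) (m : nat) := Manifold {
  mcarrier :> topologicalType;
  atlas : set (chart R m mcarrier);
  mfd_hausdorff : hausdorff_space mcarrier;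
  mfd_second_countable : @second_countable mcarrier;
  atlas_cover : forall q, exists2 c, atlas c & cdom c q;
  chart_dom_open : forall c, atlas c -> open (cdom c);
  chart_img_open : forall c, atlas c -> open (cimg c);
  chart_cancel : forall c, atlas c -> forall q, cdom c q -> cinv c (cmap c q) = q;
  chart_continuous : forall c, atlas c ->
    forall q, cdom c q -> {for q, continuous (cmap c)};
  chart_inv_continuous : forall c, atlas c ->
    forall x, cimg c x -> {for x, continuous (cinv c)};
  chart_compatible : forall c c', atlas c -> atlas c' -> forall i,
    smooth_euclid (cmap c @` (cdom c `&` cdom c'))
                  (fun x => cmap c' (cinv c x) 0 i) }.

Section Manifold.
Variables (R : realType) (m : nat) (M : manifold R m).

Definition smooth_on (W : set M) (f : M -> R) : Prop :=
  forall c, @atlas R m M c ->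
    smooth_euclid (cmap c @` (W `&` cdom c)) (f \o cinv c).

(* f is smooth on some open neighbourhood of q, i.e. represents a germ of
   smooth function at q *)
Definition smooth_at (f : M -> R) (q : M) : Prop :=
  exists2 W : set M, open_nbhs q W & smooth_on W f.

(* Tangent vectors at q are derivations of the germs of smooth functions at q.
   They are extended by 0 to the functions that are not smooth near q, so that
   equality of tangent vectors is equality in [tvec]. *)
Definition tvec := (M -> R) -> R^o.

Record tangent (q : M) (x : tvec) : Prop := Tangent {
  tangent_linear : forall a f h, smooth_at f q -> smooth_at h q ->
    x (fun r => a * f r + h r) = a * x f + x h;
  tangent_leibniz : forall f h, smooth_at f q -> smooth_at h q ->
    x (fun r => f r * h r) = x f * h q + f q * x h;
  tangent_junk : forall f, ~ smooth_at f q -> x f = 0 }.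

(* A local vector field is a total function whose values matter only on the
   open set where it is smooth. *)
Definition vfield := M -> tvec.

Definition vapp (X : vfield) (f : M -> R) : M -> R := fun q => X q f.

Definition smooth_vf (X : vfield) (p : M) : Prop :=
  \forall q \near p, tangent q (X q) /\
    forall f, smooth_at f q -> smooth_at (vapp X f) q.

Definition lie (X Y : vfield) : vfield := fun q f =>
  if `[< smooth_at f q >] then X q (vapp Y f) - Y q (vapp X f) else 0.

(** ** Riemannian metrics and Levi-Civita connections *)

Definition metric := M -> tvec -> tvec -> R.

Record riemannian (g : metric) : Prop := Riemannian {
  metric_sym : forall q x y, tangent q x -> tangent q y -> g q x y = g q y x;
  metric_linear : forall q a x y z,
    tangent q x -> tangent q y -> tangent q z ->
    g q (a *: x + y) z = a * g q x z + g q y z;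
  metric_pos : forall q x, tangent q x -> x <> 0 -> 0 < g q x x;
  metric_smooth : forall p X Y, smooth_vf X p -> smooth_vf Y p ->
    smooth_at (fun q => g q (X q) (Y q)) p }.

(* [nab Y q x] is the covariant derivative at q of the field Y, defined near q,
   in the direction of the tangent vector x. *)
Definition connection := vfield -> M -> tvec -> tvec.

Definition cov (nab : connection) (X Y : vfield) : vfield :=
  fun q => nab Y q (X q).

Record levi_civita (g : metric) (nab : connection) : Prop := LeviCivita {
  conn_tangent : forall q Y x, smooth_vf Y q -> tangent q x ->
    tangent q (nab Y q x);
  conn_smooth : forall q X Y, smooth_vf X q -> smooth_vf Y q ->
    smooth_vf (cov nab X Y) q;
  conn_linear : forall q Y a x y,
    smooth_vf Y q -> tangent q x -> tangent q y ->
    nab Y q (a *: x + y) = a *: nab Y q x + nab Y q y;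
  conn_add : forall q Y Z x, smooth_vf Y q -> smooth_vf Z q -> tangent q x ->
    nab (Y + Z) q x = nab Y q x + nab Z q x;
  conn_leibniz : forall q f Y x, smooth_at f q -> smooth_vf Y q -> tangent q x ->
    nab (fun r => f r *: Y r) q x = x f *: Y q + f q *: nab Y q x;
  conn_metric : forall q Y Z x, smooth_vf Y q -> smooth_vf Z q -> tangent q x ->
    x (fun r => g r (Y r) (Z r)) = g q (nab Y q x) (Z q) + g q (Y q) (nab Z q x);
  conn_torsion_free : forall q X Y, smooth_vf X q -> smooth_vf Y q ->
    cov nab X Y q - cov nab Y X q = lie X Y q }.

Definition on_frame (g : metric) (p : M) (F : 'I_m -> vfield) : Prop :=
  (forall a, smooth_vf (F a) p) /\
  (\forall q \near p,
     (forall a b, g q (F a q) (F b q) = (a == b)%:R) /\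
     (forall x, tangent q x ->
        exists c : 'I_m -> R, x = \sum_a c a *: F a q)).

(** ** Differential operators *)

(* Differential forms and covariant 2-tensors are given by their values on
   (local) vector fields. *)
Definition form1 := vfield -> M -> R.
Definition form2 := vfield -> vfield -> M -> R.

Section Operators.
Variables (g : metric) (nab : connection) (F : 'I_m -> vfield).

(* In the orthonormal frame F, the components of a vector and of the covector
   obtained by lowering its index coincide. *)
Definition sharp (w : form1) : vfield := fun q => \sum_b w (F b) q *: F b q.
Definition flat (v : vfield) : form1 := fun Y q => g q (v q) (Y q).

Definition d0 (f : M -> R) : form1 := fun X q => X q f.
Definition d1 (w : form1) : form2 := fun X Y q =>
  X q (w Y) - Y q (w X) - w (lie X Y) q.

Definition cov_form1 (X : vfield) (w : form1) (Y : vfield) : M -> R := fun q =>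
  X q (w Y) - w (cov nab X Y) q.
Definition cov_form2 (X : vfield) (t : form2) (Y Z : vfield) : M -> R := fun q =>
  X q (t Y Z) - t (cov nab X Y) Z q - t Y (cov nab X Z) q.

Definition grad (f : M -> R) : vfield := sharp (d0 f).

Definition div (v : vfield) : M -> R := fun q =>
  \sum_a g q (nab v q (F a q)) (F a q).

Definition div_form2 (t : form2) : form1 := fun Y q =>
  \sum_a cov_form2 (F a) t (F a) Y q.

Definition deformation (v : vfield) : form2 := fun X Y q =>
  2^-1 * (g q (nab v q (X q)) (Y q) + g q (nab v q (Y q)) (X q)).

Definition deformation_laplacian (v : vfield) : vfield := fun q =>
  (- 2) *: sharp (div_form2 (deformation v)) q.

Definition second_cov (X v : vfield) : vfield := fun q =>
  cov nab X (cov nab X v) q - cov nab (cov nab X X) v q.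

Definition bochner_laplacian (v : vfield) : vfield := fun q =>
  - \sum_a second_cov (F a) v q.

(* The codifferential d^* of a Riemannian metric on 1-forms and 2-forms,
   minus the trace of the covariant derivative *)
Definition codiff1 (w : form1) : M -> R := fun q =>
  - \sum_a cov_form1 (F a) w (F a) q.
Definition codiff2 (t : form2) : form1 := fun Y q => - div_form2 t Y q.

(* The nonnegative operator d d^* + d^* d, which is minus Delta_h *)
Definition hodge_laplacian (v : vfield) : vfield :=
  sharp (fun Y q => d0 (codiff1 (flat v)) Y q + codiff2 (d1 (flat v)) Y q).

Definition curv (X Y Z : vfield) : vfield := fun q =>
  cov nab X (cov nab Y Z) q - cov nab Y (cov nab X Z) q - cov nab (lie X Y) Z q.

Definition riem (W X Y Z : vfield) : M -> R := fun q => g q (curv W X Y q) (Z q).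

Definition ric (X Y : vfield) : M -> R := fun q => \sum_a riem (F a) X Y (F a) q.

Definition ricv (v : vfield) : vfield := sharp (ric v).

End Operators.
End Manifold.

(** * Embedded submanifolds *)

Section Submanifold.
Variables (R : realType) (n n' : nat) (M : manifold R n) (M' : manifold R n').

Definition tangent_map (iota : M -> M') (q : M) (x : tvec M) : tvec M' := fun f =>
  if `[< smooth_at f (iota q) >] then x (f \o iota) else 0.

Record embedding (iota : M -> M') : Prop := Embedding {
  emb_continuous : continuous iota;
  emb_injective : injective iota;
  emb_topology : forall U : set M, open U ->
    exists2 V : set M', open V & U = iota @^-1` V;
  emb_smooth : forall f q, smooth_at f (iota q) -> smooth_at (f \o iota) q;
  emb_immersion : forall q x, tangent q x -> tangent_map iota q x = 0 -> x = 0 }.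

Variables (iota : M -> M') (g' : metric M') (nab' : connection M').

Definition induced_metric : metric M := fun q x y =>
  g' (iota q) (tangent_map iota q x) (tangent_map iota q y).

(* Orthogonal projection of a vector of T_(iota q) M' onto T_q M; its value is
   taken in T_q M rather than in the image of T_q M. *)
Definition tproj (q : M) (x : tvec M') : tvec M :=
  xget (0 : tvec M) [set y | tangent q y /\
    forall z, tangent q z ->
      g' (iota q) (x - tangent_map iota q y) (tangent_map iota q z) = 0].

Definition nproj (q : M) (x : tvec M') : tvec M' := x - tangent_map iota q (tproj q x).

(* II(x, Y) for x in T_q M and Y a field near iota q that is tangent along M *)
Definition second_ff (Y : vfield M') (q : M) (x : tvec M) : tvec M' :=
  nproj q (nab' Y (iota q) (tangent_map iota q x)).

(* W_eta x, for eta a field near iota q that is normal along M *)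
Definition weingarten (eta : vfield M') (q : M) (x : tvec M) : tvec M :=
  - tproj q (nab' eta (iota q) (tangent_map iota q x)).

Definition mean_curvature (E : 'I_n -> vfield M) (N : vfield M') (q : M) : R :=
  n%:R^-1 * \sum_i induced_metric q (weingarten N q (E i q)) (E i q).

Definition mean_curvature_vector (E : 'I_n -> vfield M) (E' : 'I_n -> vfield M')
    (q : M) : tvec M' :=
  n%:R^-1 *: \sum_i second_ff (E' i) q (E i q).

Definition div_perp k (N : 'I_k -> vfield M') (v : vfield M') (q : M) : R :=
  \sum_l g' (iota q) (nab' v (iota q) (N l (iota q))) (N l (iota q)).

(* delta^{ij} R'(N, E_i, v, N) E_j at iota p, where the fields E' extend E *)
Definition normal_curv (E : 'I_n -> vfield M) (E' : 'I_n -> vfield M')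
    (N v : vfield M') (q : M) : tvec M :=
  \sum_i riem g' nab' N (E' i) v N (iota q) *: E i q.

End Submanifold.

(* Main.v *)
Require Import Defs.
From mathcomp Require Import all_boot all_order all_algebra.
From mathcomp Require Import all_classical all_reals all_analysis.
From mathcomp Require Import ring lra.

Set Implicit Arguments.
Unset Strict Implicit.
Unset Printing Implicit Defensive.

Import Order.TTheory GRing.Theory Num.Theory.
Import numFieldNormedType.Exports.
Local Open Scope classical_set_scope.
Local Open Scope ring_scope.

(** The terms of the formulas are tangent vectors of M at p, hence combinations of
    the frame vectors E_j p, so the formulas reduce to identities between
    coefficients.  (The unprojected [N,v] is shown to be tangent to M first.)
    Three facts produce these identities.

    1. Weitzenboeck formulas ([bochner_laplacian_comp],
       [deformation_laplacian_comp], [hodge_laplacian_comp]).  On any Riemannian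
       manifold, with the Hessian hess(X,Y)v = D_X D_Y v - D_(D_X Y) v, metric
       compatibility alone gives
         2 div Def v (Y) = sum_a <hess(F_a,F_a)v, Y> + <hess(F_a,Y)v, F_a>,
       and the codifferential of d v^flat is minus the same expression with the
       sign of the second term changed.  Since hess(X,Y) - hess(Y,X) = R(X,Y) and
       the trace of <hess(Y,F_a)v, F_a> is Y(div v), the deformation Laplacian is
       D*D v - grad div v - Ric v and the Hodge Laplacian is D*D v + Ric v.

    2. The Gauss formula ([gauss_formula], [tproj_nab]): the tangential part of
       the ambient derivative of an extension is the intrinsic derivative.
       Differentiating <D'_Y v, E_j'> along M with it yields [gauss_second]:
         <D'_X D'_Y v, E_j> = <D_X D_Y v, E_j> - sum_l b_l(Y,v) b_l(X,E_j),
       where b_l is the component of the second fundamental form along N_l.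

    3. Traces.  The ambient trace splits into tangential and normal directions.
       Taking X = Y = E_i in 2, and using that the normal parts of D'_(E_i) E_i
       add up to n H, gives the Bochner formula
       ([second_cov_tangential]); antisymmetrizing 2 gives the traced Gauss
       equation ([ricci_tangential]),
         Ric'(E_j,v) = Ric(E_j,v) - sum_l b_l(v,E_j) tr b_l
                       + sum_(l,i) b_l(v,E_i) b_l(E_i,E_j)
                       + sum_l R'(N_l,E_j,v,N_l);
       and div' v = div v + div_perp v along M.  The mean curvature term
       sum_l b_l(v,E_j) tr b_l is <n W_H v, E_j>, which turns the derivative of v
       along H into the bracket [H,v] ([metric_lie_normal]).

    Combining 1 and 3 gives [general_codimension].  The divergence free formula is
    that of the operator D*D - Ric.  For a hypersurface H = h N, and D'_N N is
    tangent to M, so that its derivative of v projects to an intrinsic one; the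
    bracket [N,v] is tangent to M because its normal component is
    div_perp v = div' v - div v.

    Underneath, smooth functions are only needed as an algebra that is closed
    under inversion of nonvanishing functions, and tangent vectors as derivations
    that depend on germs.  In place of coordinate vector fields there are the
    frames: the coefficients of a smooth field in a smooth frame are smooth by Cramer's rule applied to the
    values of the frame on finitely many functions ([frame_comp_smooth]). *)

(** * Algebra of smooth functions *)

Section EuclideanSmoothFunctions.
Variables (R : realType) (m : nat).
Implicit Types (U : set 'rV[R]_m) (f h : 'rV[R]_m -> R).

(** Order-by-order form of smoothness that peels off the innermost derivative
    instead of the outermost one, so that the Leibniz and quotient rules can be
    fed to an induction on the order. *)
Fixpoint diff_upto (N : nat) U f : Prop :=
  (forall x, U x -> {for x, continuous f} /\
     forall i, derivable f x (delta_mx 0 i)) /\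
  (if N is N'.+1 then forall i, diff_upto N' U ('D_(delta_mx 0 i) f) else True).

Lemma partials_rcons s (i : 'I_m) f :
  partials (rcons s i) f = partials s ('D_(delta_mx 0 i) f).
Proof. by elim: s => //= j s ->. Qed.

Lemma diff_upto1 N U f : diff_upto N U f -> forall x, U x ->
  {for x, continuous f} /\ forall i, derivable f x (delta_mx 0 i).
Proof. by case: N => [|N] /= []. Qed.

Lemma diff_uptoW N U f : diff_upto N.+1 U f -> diff_upto N U f.
Proof.
elim: N f => [|N IH] f [f1 fS]; split=> // i.
by apply: IH; exact: fS.
Qed.

Lemma smooth_euclidP U f : smooth_euclid U f <-> forall N, diff_upto N U f.
Proof.
split=> [sf N|df].
  elim: N f sf => [|N IH] f sf; split=> //; try exact: (sf [::]).
  by move=> i; apply: IH => s; have := sf (rcons s i); rewrite partials_rcons.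
move=> s x Ux; elim/last_ind: s f df => [|s i IH] f df.
  exact: (diff_upto1 (df 0%N)).
by rewrite partials_rcons; apply: IH => N; have [_] := df N.+1; apply.
Qed.

Lemma diff_upto_eq N U f h : open U -> (forall x, U x -> f x = h x) ->
  diff_upto N U f -> diff_upto N U h.
Proof.
move=> oU.
have nbh f' h' x : (forall x, U x -> f' x = h' x) -> U x ->
    \forall y \near x, f' y = h' y.
  move=> fh Ux; have : nbhs x U by exact: open_nbhs_nbhs.
  by apply: filterS => y; exact: fh.
have fh1 f' h' : (forall x, U x -> f' x = h' x) ->
    (forall x, U x -> {for x, continuous f'} /\
       forall i, derivable f' x (delta_mx 0 i)) ->
    forall x, U x -> {for x, continuous h'} /\
       forall i, derivable h' x (delta_mx 0 i).
  move=> fh f1 x Ux; have [cf df] := f1 x Ux; split.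
    rewrite /prop_for /continuous_at -(fh x Ux); apply: cvg_trans cf.
    by apply: near_eq_cvg; [exact: nbhs_filter | exact: (nbh _ _ _ fh Ux)].
  by move=> i; apply: near_eq_derivable (df i); exact: (nbh _ _ _ fh Ux).
elim: N f h => [|N IH] f h fh [f1 fS]; split; [exact: fh1 fh f1|by []|exact: fh1 fh f1|].
move=> i; apply: IH (fS i) => x Ux; apply: near_eq_derive.
exact: nbh.
Qed.

Lemma diff_upto_cst N U (a : R) : diff_upto N U (fun=> a).
Proof.
have c1 (b : R) x : U x -> {for x, continuous (fun=> b : R)} /\
    forall i : 'I_m, derivable (fun=> b : R) x (delta_mx 0 i).
  by move=> _; split; [exact: cst_continuous|move=> i; exact: derivable_cst].
elim: N a => [|N IH] a; split=> //; try exact: c1.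
move=> i; have -> : 'D_(delta_mx 0 i) (fun=> a) = (fun=> 0) :> ('rV[R]_m -> R).
  by apply/funext => x; rewrite (derive_cst a).
exact: IH.
Qed.

Lemma diff_uptoD N U f h : open U -> diff_upto N U f -> diff_upto N U h ->
  diff_upto N U (fun x => f x + h x).
Proof.
move=> oU; elim: N f h => [|N IH] f h df dh.
  split=> // x Ux; have [cf {}df] := diff_upto1 df Ux.
  have [ch {}dh] := diff_upto1 dh Ux.
  by split=> [|i]; [exact: (continuousD cf ch)|exact: derivableD].
have [[f1 fS] [h1 hS]] := (df, dh); split=> [x Ux|].
  exact: (diff_upto1 (IH _ _ (diff_uptoW df) (diff_uptoW dh))).
move=> i; apply: (diff_upto_eq oU _ (IH _ _ (fS i) (hS i))) => x Ux /=.
by rewrite (@deriveD _ _ _ f h) //; [case: (f1 x Ux)|case: (h1 x Ux)].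
Qed.

(** The derivative of a product involves the factors and their derivatives, all
    of which are differentiable to the lower order. *)
Lemma diff_uptoM N U f h : open U -> diff_upto N U f -> diff_upto N U h ->
  diff_upto N U (fun x => f x * h x).
Proof.
move=> oU; elim: N f h => [|N IH] f h df dh.
  split=> // x Ux; have [cf {}df] := diff_upto1 df Ux.
  have [ch {}dh] := diff_upto1 dh Ux.
  by split=> [|i]; [exact: (continuousM cf ch)|exact: derivableM].
have fW := diff_uptoW df; have hW := diff_uptoW dh; split=> [x Ux|i].
  exact: (diff_upto1 (IH _ _ fW hW)).
have [_ /(_ i) fS] := df; have [_ /(_ i) hS] := dh.
apply: (diff_upto_eq oU _ (diff_uptoD oU (IH _ _ fW hS) (IH _ _ hW fS))) => x Ux /=.
by rewrite (@deriveM _ _ f h) //;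
  [case: (diff_upto1 df Ux)|case: (diff_upto1 dh Ux)].
Qed.

(** By induction, as (1/f)' = - (1/f) (1/f) f' is a product of functions
    differentiable to the lower order. *)
Lemma diff_uptoV N U f : open U -> (forall x, U x -> f x != 0) ->
  diff_upto N U f -> diff_upto N U (fun x => (f x)^-1).
Proof.
move=> oU f0; elim: N f f0 => [|N IH] f f0 df.
  split=> // x Ux; have [cf {}df] := diff_upto1 df Ux.
  by split=> [|i]; [apply: continuousV => //|apply: derivableV => //]; exact: f0.
have iW := IH _ f0 (diff_uptoW df); split=> [x Ux|i].
  exact: (diff_upto1 iW).
have [_ /(_ i) fS] := df.
apply: (diff_upto_eq oU _ (diff_uptoM oU (diff_upto_cst N U (-1))
  (diff_uptoM oU (diff_uptoM oU iW iW) fS))) => x Ux /=.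
rewrite deriveV ?f0 //; last by case: (diff_upto1 df Ux).
by rewrite expr2 invfM mulN1r scaleNr.
Qed.

End EuclideanSmoothFunctions.

Section SmoothFunctions.
Variables (R : realType) (m : nat) (M : manifold R m).
Implicit Types (f h : M -> R) (q : M).

(** Partial derivatives are local on open sets, so this is what makes smoothness
    on W insensitive to the values outside W. *)
Lemma chart_image_open (c : chart R m M) (W : set M) : @atlas R m M c -> open W ->
  open (cmap c @` (W `&` cdom c)).
Proof.
move=> ac oW; rewrite openE => _ [q [Wq dq] <-].
have ix : cimg c (cmap c q) by exists q.
have cW : nbhs (cmap c q) (cinv c @^-1` W).
  apply: (chart_inv_continuous ac ix); rewrite (chart_cancel ac) //.
  exact: open_nbhs_nbhs.
have ci : nbhs (cmap c q) (cimg c).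
  by apply: open_nbhs_nbhs; split=> //; exact: chart_img_open.
rewrite /interior; apply: filterS (filterI cW ci) => y /= [Wy [r dr ry]].
by exists r => //; split=> //; move: Wy; rewrite -ry /preimage /= (chart_cancel ac).
Qed.

Lemma smooth_on_diff (W : set M) f c N : smooth_on W f -> @atlas R m M c ->
  diff_upto N (cmap c @` (W `&` cdom c)) (f \o cinv c).
Proof. by move=> sf ac; move/smooth_euclidP: (sf c ac). Qed.

Lemma smooth_on_sub (W V : set M) f : V `<=` W -> smooth_on W f -> smooth_on V f.
Proof.
by move=> VW sf c ac s x [q [Vq dq] <-]; apply: sf => //; exists q => //; split=> //; exact: VW.
Qed.

Lemma smooth_at_near f q : smooth_at f q -> \forall r \near q, smooth_at f r.
Proof.
move=> [W [oW Wq] sf]; have : nbhs q W by exact: open_nbhs_nbhs.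
by apply: filterS => r Wr; exists W.
Qed.

Lemma near_open_nbhs q (P : M -> Prop) : (\forall r \near q, P r) ->
  exists2 W : set M, open_nbhs q W & forall r, W r -> P r.
Proof. by move=> qP; have : nbhs q P by []; rewrite nbhsE => -[W oW WP]; exists W. Qed.

Lemma smooth_at_eq f h q : (\forall r \near q, f r = h r) -> smooth_at f q ->
  smooth_at h q.
Proof.
move=> /near_open_nbhs[V [oV Vq] fh] [W [oW Wq] sf].
exists (W `&` V); first by split; [exact: openI|].
have oWV : open (W `&` V) by exact: openI.
move=> c ac; apply/smooth_euclidP => N.
apply: (diff_upto_eq (chart_image_open ac oWV) _
  (smooth_on_diff N (smooth_on_sub _ sf) ac)) => [|r []//].
by move=> _ [r [[_ Vr] dr] <-] /=; rewrite (chart_cancel ac) // fh.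
Qed.

Lemma smooth_at_cst (a : R) q : smooth_at (fun=> a) q.
Proof.
exists setT; first by split; [exact: openT|].
by move=> c ac; apply/smooth_euclidP => N; exact: diff_upto_cst.
Qed.

Lemma smooth_at_op2 (op : R -> R -> R) f h q :
  (forall N (U : set 'rV[R]_m) (f' h' : 'rV[R]_m -> R), open U -> diff_upto N U f' -> diff_upto N U h' ->
     diff_upto N U (fun x => op (f' x) (h' x))) ->
  smooth_at f q -> smooth_at h q -> smooth_at (fun r => op (f r) (h r)) q.
Proof.
move=> Hop [W [oW Wq] sf] [V [oV Vq] sh].
have oWV : open (W `&` V) by exact: openI.
exists (W `&` V); first by split.
move=> c ac; apply/smooth_euclidP => N; apply: Hop; first exact: chart_image_open.
- by apply: smooth_on_diff ac; apply: smooth_on_sub sf => r [].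
- by apply: smooth_on_diff ac; apply: smooth_on_sub sh => r [].
Qed.

Lemma smooth_atD f h q : smooth_at f q -> smooth_at h q ->
  smooth_at (fun r => f r + h r) q.
Proof. by apply: smooth_at_op2 => *; exact: diff_uptoD. Qed.

Lemma smooth_atM f h q : smooth_at f q -> smooth_at h q ->
  smooth_at (fun r => f r * h r) q.
Proof. by apply: smooth_at_op2 => *; exact: diff_uptoM. Qed.

Lemma smooth_atZ (a : R) f q : smooth_at f q -> smooth_at (fun r => a * f r) q.
Proof. by apply: smooth_atM; exact: smooth_at_cst. Qed.

Lemma smooth_atN f q : smooth_at f q -> smooth_at (fun r => - f r) q.
Proof.
move=> sf; apply: smooth_at_eq (smooth_atZ (-1) sf).
by apply: nearW => r; rewrite mulN1r.
Qed.

Lemma smooth_atB f h q : smooth_at f q -> smooth_at h q ->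
  smooth_at (fun r => f r - h r) q.
Proof. by move=> sf sh; apply: smooth_atD; [exact: sf|exact: smooth_atN]. Qed.

Lemma smooth_at_sum (I : Type) (s : seq I) (P : pred I) (f : I -> M -> R) q :
  (forall i, smooth_at (f i) q) -> smooth_at (fun r => \sum_(i <- s | P i) f i r) q.
Proof.
move=> sf; elim: s => [|i s IH].
  by apply: smooth_at_eq (smooth_at_cst 0 q); apply: nearW => r; rewrite big_nil.
case Pi : (P i); last first.
  by apply: smooth_at_eq IH; apply: nearW => r; rewrite big_cons Pi.
by apply: smooth_at_eq (smooth_atD (sf i) IH); apply: nearW => r; rewrite big_cons Pi.
Qed.

Lemma smooth_at_prod (I : Type) (s : seq I) (P : pred I) (f : I -> M -> R) q :
  (forall i, smooth_at (f i) q) -> smooth_at (fun r => \prod_(i <- s | P i) f i r) q.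
Proof.
move=> sf; elim: s => [|i s IH].
  by apply: smooth_at_eq (smooth_at_cst 1 q); apply: nearW => r; rewrite big_nil.
case Pi : (P i); last first.
  by apply: smooth_at_eq IH; apply: nearW => r; rewrite big_cons Pi.
by apply: smooth_at_eq (smooth_atM (sf i) IH); apply: nearW => r; rewrite big_cons Pi.
Qed.

Lemma continuous_near_neq0 (W : set M) f q : open_nbhs q W -> smooth_on W f ->
  f q != 0 -> \forall r \near q, f r != 0.
Proof.
move=> [oW Wq] sf fq; have [c ac dq] := @atlas_cover R m M q.
have xU : (cmap c @` (W `&` cdom c)) (cmap c q) by exists q.
have [cf _] := sf c ac [::] _ xU.
have cc : {for q, continuous (cmap c)} by exact: chart_continuous dq.
have oc : nbhs q (cdom c).
  by apply: open_nbhs_nbhs; split=> //; exact: chart_dom_open.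
have fc : (f \o cinv c) x @[x --> cmap c q] --> f q.
  by have := cf; rewrite /prop_for /continuous_at /= (chart_cancel ac).
have f0 : \forall x \near cmap c q, f (cinv c x) != 0.
  by apply: (fc [set y | y != 0]); apply: open_nbhs_nbhs; split=> //; exact: open_neq.
have f1 : \forall r \near q, f (cinv c (cmap c r)) != 0 by exact: cc f0.
apply: filterS (filterI oc f1) => r [dr].
by rewrite (chart_cancel ac).
Qed.

Lemma smooth_atV f q : f q != 0 -> smooth_at f q ->
  smooth_at (fun r => (f r)^-1) q.
Proof.
move=> fq [W oW sf].
have [V [oV Vq] f0] := near_open_nbhs (continuous_near_neq0 oW sf fq).
have oWV : open (W `&` V) by apply: openI => //; case: oW.
exists (W `&` V); first by split => //; case: oW.
move=> c ac; apply/smooth_euclidP => N; apply: diff_uptoV.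
- exact: chart_image_open.
- by move=> _ [r [[_ Vr] dr] <-] /=; rewrite (chart_cancel ac) // f0.
- by apply: smooth_on_diff ac; apply: smooth_on_sub sf => r [].
Qed.

End SmoothFunctions.

(** * Tangent vectors and smooth vector fields *)

Section TangentVectors.
Variables (R : realType) (m : nat) (M : manifold R m).
Implicit Types (f h : M -> R) (q : M) (x y : tvec M) (X Y : vfield M).

Lemma tvecD x y f : (x + y) f = x f + y f. Proof. by []. Qed.
Lemma tvecZ (a : R) x f : (a *: x) f = a * x f. Proof. by []. Qed.
Lemma tvecN x f : (- x) f = - x f. Proof. by []. Qed.
Lemma tvec0 f : (0 : tvec M) f = 0. Proof. by []. Qed.
Lemma vfieldD X Y q : (X + Y) q = X q + Y q. Proof. by []. Qed.
Lemma tvec_sum (I : Type) (s : seq I) (P : pred I) (x : I -> tvec M) f :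
  (\sum_(i <- s | P i) x i) f = \sum_(i <- s | P i) x i f.
Proof. by elim/big_rec2: _ => //= i u w _ <-. Qed.

Lemma tangent0 q : tangent q (0 : tvec M).
Proof. by split=> * /=; rewrite /GRing.zero /= ?mulr0 ?mul0r ?addr0. Qed.

Lemma tangent_lin q (a : R) x y : tangent q x -> tangent q y -> tangent q (a *: x + y).
Proof.
move=> [xl xm xj] [yl ym yj]; split=> [b f h sf sh|f h sf sh|f nf];
  rewrite !tvecD !tvecZ.
- by rewrite xl // yl //; ring.
- by rewrite xm // ym //; ring.
- by rewrite xj // yj // mulr0 addr0.
Qed.

Lemma tangentD q x y : tangent q x -> tangent q y -> tangent q (x + y).
Proof. by move=> tx ty; have := tangent_lin 1 tx ty; rewrite scale1r. Qed.

Lemma tangentZ q (a : R) x : tangent q x -> tangent q (a *: x).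
Proof. by move=> tx; have := tangent_lin a tx (tangent0 q); rewrite addr0. Qed.

Lemma tangentN q x : tangent q x -> tangent q (- x).
Proof. by move=> tx; rewrite -scaleN1r; exact: tangentZ. Qed.

Lemma tangentB q x y : tangent q x -> tangent q y -> tangent q (x - y).
Proof. by move=> tx ty; apply: tangentD => //; exact: tangentN. Qed.

Lemma tangent_sum q (I : Type) (s : seq I) (P : pred I) (x : I -> tvec M) :
  (forall i, tangent q (x i)) -> tangent q (\sum_(i <- s | P i) x i).
Proof. by move=> tx; elim/big_ind: _ => //; [exact: tangent0|exact: tangentD]. Qed.

Section Derivation.
Variables (q : M) (x : tvec M).
Hypothesis tx : tangent q x.

Lemma tangent_cst (a : R) : x (fun=> a) = 0.
Proof.
have s c : smooth_at (fun _ : M => c : R) q := smooth_at_cst c q.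
have x0 : x (fun=> 0) = 0.
  have := tangent_linear tx (-1) (s 0) (s 0).
  have -> : (fun _ : M => -1 * 0 + 0 : R) = (fun=> 0).
    by apply/funext => r; rewrite mulr0 addr0.
  by rewrite mulN1r addNr.
have x1 : x (fun=> 1) = 0.
  have := tangent_leibniz tx (s 1) (s 1).
  rewrite !mulr1 mul1r => /eqP.
  by rewrite -subr_eq subrr eq_sym => /eqP.
by have := tangent_linear tx a (s 1) (s 0); rewrite x1 x0 !(mulr0, addr0, mulr1).
Qed.

Lemma tangent_addf f h : smooth_at f q -> smooth_at h q ->
  x (fun r => f r + h r) = x f + x h.
Proof.
move=> sf sh; have := tangent_linear tx 1 sf sh; rewrite mul1r => <-.
by congr (x _); apply/funext => r; rewrite mul1r.
Qed.

Lemma tangent_scalef (a : R) f : smooth_at f q -> x (fun r => a * f r) = a * x f.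
Proof.
move=> sf; have := tangent_linear tx a sf (smooth_at_cst 0 q).
rewrite tangent_cst addr0 => <-.
by congr (x _); apply/funext => r; rewrite addr0.
Qed.

Lemma tangent_oppf f : smooth_at f q -> x (fun r => - f r) = - x f.
Proof.
move=> sf; rewrite -mulN1r -tangent_scalef //; congr (x _).
by apply/funext => r; rewrite mulN1r.
Qed.

Lemma tangent_subf f h : smooth_at f q -> smooth_at h q ->
  x (fun r => f r - h r) = x f - x h.
Proof.
move=> sf sh; rewrite tangent_addf; [|exact: sf|exact: smooth_atN].
by rewrite tangent_oppf.
Qed.

Lemma tangent_sumf (I : Type) (s : seq I) (f : I -> M -> R) :
  (forall i, smooth_at (f i) q) ->
  x (fun r => \sum_(i <- s) f i r) = \sum_(i <- s) x (f i).
Proof.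
move=> sf; elim: s => [|i s IH].
  rewrite big_nil -[RHS](tangent_cst 0); congr (x _).
  by apply/funext => r; rewrite big_nil.
rewrite big_cons -IH -tangent_addf //; last exact: smooth_at_sum.
by congr (x _); apply/funext => r; rewrite big_cons.
Qed.

(** A derivation sees only germs.  An indicator function plays the role of a bump
    function: if f = h on an open W, then f - h equals chi (f - h), where chi is 0
    on W and 1 elsewhere; chi is smooth at q because it is locally constant there,
    and the Leibniz rule kills the product as both factors vanish at q. *)
Lemma tangent_near f h : (\forall r \near q, f r = h r) -> x f = x h.
Proof.
move=> fh; have hf : \forall r \near q, h r = f r by apply: filterS fh.
have [sf|nf] := pselect (smooth_at f q); last first.
  rewrite (tangent_junk tx nf) (tangent_junk tx); [by []|move=> sh; apply: nf].
  exact: smooth_at_eq sh.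
have sh := smooth_at_eq fh sf.
have su := smooth_atB sf sh.
have [W [oW Wq] fhW] := near_open_nbhs fh.
pose chi := fun r => if r \in W then 0 : R else 1.
have schi : smooth_at chi q.
  apply: smooth_at_eq (smooth_at_cst 0 q).
  have : nbhs q W by exact: open_nbhs_nbhs.
  by apply: filterS => r Wr; rewrite /chi mem_set.
have := tangent_leibniz tx schi su.
have -> : (fun r => chi r * (f r - h r)) = (fun r => f r - h r).
  apply/funext => r; rewrite /chi; case: ifPn; last by rewrite mul1r.
  by move=> /set_mem Wr; rewrite fhW // subrr mulr0.
rewrite {2}/chi mem_set // fhW // subrr mulr0 mul0r addr0 tangent_subf //.
by move/eqP; rewrite subr_eq0 => /eqP.
Qed.

End Derivation.

(** A record around [smooth_vf] is rigid for conversion: comparing two smoothness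
    statements compares the fields and never unfolds neighbourhood filters. *)
Record smooth_field X q : Prop := SmoothField { smooth_fieldP : smooth_vf X q }.

Lemma smooth_field_tangent X q : smooth_field X q -> tangent q (X q).
Proof. by move=> [/nbhs_singleton[]]. Qed.

Lemma smooth_field_app X q f :
  smooth_field X q -> smooth_at f q -> smooth_at (vapp X f) q.
Proof. by move=> [/nbhs_singleton[_]]; apply. Qed.

Lemma smooth_field_near X q : smooth_field X q -> \forall r \near q, smooth_field X r.
Proof. by move=> [/near_join]; apply: filterS => r sX; split. Qed.

Lemma smooth_field_eq X Y q : (\forall r \near q, X r = Y r) ->
  smooth_field X q -> smooth_field Y q.
Proof.
move=> XY [sX]; split; apply: filterS2 (near_join XY) sX => r XYr [tX sXr].
split; first by rewrite -(nbhs_singleton XYr).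
move=> f sf; apply: smooth_at_eq (sXr f sf).
by apply: filterS XYr => r'; rewrite /vapp => ->.
Qed.

Lemma smooth_fieldD X Y q :
  smooth_field X q -> smooth_field Y q -> smooth_field (X + Y) q.
Proof.
move=> [sX] [sY]; split; apply: filterS2 sX sY => r [tX sX] [tY sY].
split; first exact: tangentD.
by move=> f sf; apply: smooth_atD; [exact: sX|exact: sY].
Qed.

Lemma smooth_fieldZ f X q : smooth_at f q -> smooth_field X q ->
  smooth_field (fun r => f r *: X r) q.
Proof.
move=> /smooth_at_near sf [sX]; split; apply: filterS2 sf sX => r sf [tX sX].
split; first exact: tangentZ.
by move=> h sh; apply: smooth_atM; [exact: sf|exact: sX].
Qed.

Lemma smooth_fieldZc (a : R) X q : smooth_field X q -> smooth_field (fun r => a *: X r) q.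
Proof. by apply: smooth_fieldZ; exact: smooth_at_cst. Qed.

End TangentVectors.

(** The pointwise part of a Riemannian metric.  It is stated separately because
    smoothness of the induced metric is a consequence of the existence of frames,
    see [frame_metric_smooth]. *)
Record bilinear_metric (R : realType) (m : nat) (M : manifold R m) (g : metric M) :
  Prop := BilinearMetric {
  bilinear_sym : forall q x y, tangent q x -> tangent q y -> g q x y = g q y x;
  bilinear_lin : forall q a x y z, tangent q x -> tangent q y -> tangent q z ->
    g q (a *: x + y) z = a * g q x z + g q y z }.

(** * Orthonormal frames *)

Section Frames.
Variables (R : realType) (m : nat) (M : manifold R m) (g : metric M).
Hypothesis hg : bilinear_metric g.
Implicit Types (q : M) (x y z : tvec M) (X Y : vfield M).

Section PointwiseMetric.
Variable q : M.

Lemma metric0l z : tangent q z -> g q 0 z = 0.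
Proof.
move=> tz; have t0 := tangent0 q.
have := bilinear_lin hg 1 t0 t0 tz; rewrite scale1r addr0 mul1r => /eqP.
by rewrite -subr_eq subrr eq_sym => /eqP.
Qed.

Lemma metricDl x y z : tangent q x -> tangent q y -> tangent q z ->
  g q (x + y) z = g q x z + g q y z.
Proof.
by move=> tx ty tz; have := bilinear_lin hg 1 tx ty tz; rewrite scale1r mul1r.
Qed.

Lemma metricZl a x z : tangent q x -> tangent q z -> g q (a *: x) z = a * g q x z.
Proof.
move=> tx tz; have := bilinear_lin hg a tx (tangent0 q) tz.
by rewrite addr0 metric0l // addr0.
Qed.

Lemma metricNl x z : tangent q x -> tangent q z -> g q (- x) z = - g q x z.
Proof. by move=> tx tz; rewrite -scaleN1r metricZl // mulN1r. Qed.

Lemma metricBl x y z : tangent q x -> tangent q y -> tangent q z ->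
  g q (x - y) z = g q x z - g q y z.
Proof. by move=> tx ty tz; rewrite metricDl ?metricNl //; exact: tangentN. Qed.

Lemma metric_suml (I : Type) (s : seq I) (x : I -> tvec M) z :
  (forall i, tangent q (x i)) -> tangent q z ->
  g q (\sum_(i <- s) x i) z = \sum_(i <- s) g q (x i) z.
Proof.
move=> tx tz; elim: s => [|i s IH]; first by rewrite !big_nil metric0l.
by rewrite !big_cons metricDl ?IH //; exact: tangent_sum.
Qed.

Lemma metricZr a x z : tangent q x -> tangent q z -> g q z (a *: x) = a * g q z x.
Proof.
by move=> tx tz; rewrite !(bilinear_sym hg tz) ?metricZl //; exact: tangentZ.
Qed.

Lemma metric_sumr (I : Type) (s : seq I) (x : I -> tvec M) z :
  (forall i, tangent q (x i)) -> tangent q z ->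
  g q z (\sum_(i <- s) x i) = \sum_(i <- s) g q z (x i).
Proof.
move=> tx tz; rewrite (bilinear_sym hg tz) ?metric_suml //; last exact: tangent_sum.
by apply: eq_bigr => i _; rewrite (bilinear_sym hg tz).
Qed.

End PointwiseMetric.

Variable F : 'I_m -> vfield M.

Lemma on_frame_near q : on_frame g q F -> \forall r \near q, on_frame g r F.
Proof.
move=> [sF oF].
have sF' : \forall r \near q, forall a, smooth_vf (F a) r.
  by apply: filter_forall => a; exact: (near_join (sF a)).
by apply: filterS2 sF' (near_join oF) => r ? ?; split.
Qed.

Section AtPoint.
Variable q : M.
Hypothesis hF : on_frame g q F.

Lemma frame_smooth a : smooth_field (F a) q. Proof. by split; exact: hF.1. Qed.
Lemma frame_tangent a : tangent q (F a q).
Proof. exact/smooth_field_tangent/frame_smooth. Qed.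
Lemma frame_orthonormal a b : g q (F a q) (F b q) = (a == b)%:R.
Proof. by have [H _] := nbhs_singleton hF.2. Qed.

Lemma frame_sum_tangent (c : 'I_m -> R) : tangent q (\sum_a c a *: F a q).
Proof. by apply: tangent_sum => a; apply: tangentZ; exact: frame_tangent. Qed.

Lemma frame_comp (c : 'I_m -> R) b : g q (\sum_a c a *: F a q) (F b q) = c b.
Proof.
have tF := frame_tangent.
rewrite metric_suml //; last by move=> a; exact: tangentZ.
rewrite (bigD1 b) //= metricZl // frame_orthonormal eqxx mulr1 big1 ?addr0 //.
by move=> a /negPf ab; rewrite metricZl // frame_orthonormal ab mulr0.
Qed.

Lemma frame_expand x : tangent q x -> x = \sum_a g q x (F a q) *: F a q.
Proof.
move=> tx; have [_ /(_ x tx)[c xc]] := nbhs_singleton hF.2.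
by rewrite {1}xc; apply: eq_bigr => a _; rewrite xc frame_comp.
Qed.

Lemma frame_ext x y : tangent q x -> tangent q y ->
  (forall a, g q x (F a q) = g q y (F a q)) -> x = y.
Proof.
move=> tx ty xy; rewrite (frame_expand tx) (frame_expand ty).
by apply: eq_bigr => a _; rewrite xy.
Qed.

Lemma frame_parseval x y : tangent q x -> tangent q y ->
  g q x y = \sum_a g q x (F a q) * g q y (F a q).
Proof.
move=> tx ty; rewrite {1}(frame_expand ty) metric_sumr //; last first.
  by move=> a; apply: tangentZ; exact: frame_tangent.
by apply: eq_bigr => a _; rewrite metricZr //; [rewrite mulrC|exact: frame_tangent].
Qed.

(** If the values of the frame on the functions f_j have rank less than m, some
    nonzero combination x of the frame vectors kills every f_j.  Being nonzero, x
    does not kill some smooth h, and the row of values on h is then independent of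
    the previous ones. *)
Lemma frame_separating k (f : 'I_k -> M -> R) :
  let A := \matrix_(j < k, i < m) F i q (f j) in
  (forall j, smooth_at (f j) q) -> (\rank A < m)%N ->
  exists2 h, smooth_at h q &
    (\rank A < \rank (col_mx A (\row_i F i q h)))%N.
Proof.
move=> A sf rA.
have : cokermx A != 0 by rewrite -mxrank_eq0 mxrank_coker -lt0n subn_gt0.
case/matrix0Pn => i0 [j0 c0]; pose c : 'cV[R]_m := col j0 (cokermx A).
have Ac : A *m c = 0 by rewrite /c colE mulmxA mulmx_coker mul0mx.
pose x : tvec M := \sum_i c i 0 *: F i q.
have tx : tangent q x by exact: frame_sum_tangent.
have x0 : x <> 0.
  move=> xz; have := frame_comp (c^~ 0) i0; rewrite -/x xz metric0l.
    by rewrite mxE => /esym/eqP; rewrite (negPf c0).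
  exact: frame_tangent.
have [h xh] : exists h, x h <> 0.
  by apply/existsNP => xz; apply: x0; apply/funext.
have sh : smooth_at h q by apply/not_notP => nh; apply: xh; exact: tangent_junk nh.
exists h => //; apply: rank_ltmx.
rewrite /ltmx; apply/andP; split.
  by apply: (@submx_trans _ _ _ _ _ _ (A + \row_i F i q h)%MS);
    rewrite ?addsmxSl // addsmxE.
apply/negP => /submxP[D]; move/(congr1 dsubmx); rewrite col_mxKd -mul_dsub_mx => e.
apply: xh; have := congr1 (fun B => (B *m c) 0 0) e.
rewrite /= -mulmxA Ac mulmx0 [RHS]mxE mxE => <-.
by rewrite /x tvec_sum; apply: eq_bigr => i _; rewrite tvecZ !mxE mulrC.
Qed.

(** A family of functions of maximal rank has rank m by [frame_separating]; m of
    its rows are then independent. *)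
Lemma frame_dual_functions : exists2 f : 'I_m -> M -> R,
  forall j, smooth_at (f j) q & \det (\matrix_(i, j) F i q (f j)) != 0.
Proof.
pose P (r : nat) := `[< exists k (f : 'I_k -> M -> R), (forall j, smooth_at (f j) q) /\
  \rank (\matrix_(j < k, i < m) F i q (f j)) = r >].
have exP : exists r, P r.
  by exists (\rank (\matrix_(j < 0, i < m) F i q (fun=> 0))); apply/asboolP;
    exists 0%N, (fun=> fun=> 0); split=> // -[].
have Pm r : P r -> (r <= m)%N by move=> /asboolP[k [f [_ <-]]]; exact: rank_leq_col.
(* A family of functions on which the frame has maximal rank. *)
have [r /asboolP[k [f [sf rf]]] rmax] := ex_maxnP exP Pm.
have fullf : row_full (\matrix_(j < k, i < m) F i q (f j)).
  rewrite /row_full; apply/negPn/negP => rm.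
  have [|h sh] := frame_separating sf.
    by rewrite ltn_neqAle rm rank_leq_col.
  rewrite rf ltnNge => /negP; apply; apply: rmax; apply/asboolP.
  exists (k + 1)%N, (fun j : 'I_(k + 1) => match fintype.split j with inl j => f j | inr _ => h end).
  split; first by move=> j; case: (fintype.split j).
  congr (\rank _); apply/matrixP => j i; rewrite !mxE.
  by case: (fintype.split j) => j'; rewrite !mxE.
pose s := fullrankfun fullf; exists (fun j => f (s j)) => //.
rewrite -det_tr -unitfE -unitmxE.
have <- : rowsub s (\matrix_(j < k, i < m) F i q (f j)) =
    (\matrix_(i, j) F i q (f (s j)))^T by apply/matrixP => i j; rewrite !mxE.
exact: fullrowsub_unit.
Qed.

End AtPoint.

Lemma smooth_at_det q d (A : M -> 'M[R]_d) :
  (forall i j, smooth_at (fun r => A r i j) q) -> smooth_at (fun r => \det (A r)) q.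
Proof.
move=> sA; rewrite /determinant; apply: smooth_at_sum => s.
by apply: smooth_atZ; apply: smooth_at_prod => i; exact: sA.
Qed.

(** The coefficients c of X solve the linear system X f_j = sum_i c_i F_i f_j with
    smooth entries and nonzero determinant, hence are smooth by Cramer's rule. *)
Lemma frame_comp_smooth q X a : on_frame g q F -> smooth_field X q ->
  smooth_at (fun r => g r (X r) (F a r)) q.
Proof.
move=> hF sX; have [f sf] := frame_dual_functions hF.
pose B r := \matrix_(i, j) F i r (f j); rewrite -/(B q) => dB.
have sB i j : smooth_at (fun r => B r i j) q.
  apply: smooth_at_eq (smooth_field_app (frame_smooth hF i) (sf j)).
  by apply: nearW => r; rewrite mxE.
have sdB : smooth_at (fun r => \det (B r)) q by exact: smooth_at_det.
have ssum : smooth_at (fun r => \sum_j X r (f j) * \adj (B r) j a) q.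
  apply: smooth_at_sum => j; apply: smooth_atM; first exact: (smooth_field_app sX (sf j)).
  have : smooth_at (fun r => cofactor (B r) a j) q.
    apply: smooth_atZ; apply: smooth_at_det => i' j'.
    by apply: smooth_at_eq (sB (lift a i') (lift j j')); apply: nearW => r; rewrite !mxE.
  by apply: smooth_at_eq; apply: nearW => r; rewrite mxE.
apply: smooth_at_eq (smooth_atM (smooth_atV dB sdB) ssum).
have dBr : \forall r \near q, \det (B r) != 0.
  by have [W oW sW] := sdB; exact: continuous_near_neq0 oW sW dB.
apply: filterS3 dBr (on_frame_near hF) (smooth_field_near sX) => r dr hFr sXr.
pose c := \row_i g r (X r) (F i r).
have cB : c *m B r = \row_j X r (f j).
  apply/rowP => j; rewrite !mxE {1}(frame_expand hFr (smooth_field_tangent sXr)) tvec_sum.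
  by apply: eq_bigr => i _; rewrite !mxE.
have := congr1 (fun u => (u *m \adj (B r)) 0 a) cB.
rewrite /= -mulmxA mul_mx_adj mul_mx_scalar mxE => e.
have -> : \sum_j X r (f j) * \adj (B r) j a = \det (B r) * c 0 a.
  by rewrite e mxE; apply: eq_bigr => j _; rewrite [in RHS]mxE.
by rewrite mulKf // mxE.
Qed.

Lemma frame_metric_smooth q X Y : on_frame g q F -> smooth_field X q -> smooth_field Y q ->
  smooth_at (fun r => g r (X r) (Y r)) q.
Proof.
move=> hF sX sY.
have s : smooth_at (fun r => \sum_a g r (X r) (F a r) * g r (Y r) (F a r)) q.
  by apply: smooth_at_sum => a; apply: smooth_atM; exact: frame_comp_smooth.
apply: smooth_at_eq s.
apply: filterS3 (on_frame_near hF) (smooth_field_near sX) (smooth_field_near sY) => r hFr sXr sYr.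
by rewrite -(frame_parseval hFr) //; exact: smooth_field_tangent.
Qed.

End Frames.

(** * Calculus of the Levi-Civita connection *)

(** Tensorial second derivative; its diagonal is [second_cov] and its
    antisymmetric part is the curvature. *)
Definition hess (R : realType) (m : nat) (M : manifold R m) (nab : connection M)
    (X Y v : vfield M) : vfield M := fun q =>
  cov nab X (cov nab Y v) q - cov nab (cov nab X Y) v q.

Section LeviCivitaCalculus.
Variables (R : realType) (m : nat) (M : manifold R m) (g : metric M).
Variable nab : connection M.
Hypotheses (hg : bilinear_metric g) (hnab : levi_civita g nab).
Implicit Types (q : M) (x y z : tvec M) (X Y Z W v : vfield M).

Lemma nab_tangent q Y x : smooth_field Y q -> tangent q x -> tangent q (nab Y q x).
Proof. by case=> sY; move=> tx; exact: (conn_tangent hnab sY tx). Qed.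

Lemma cov_smooth q X Y :
  smooth_field X q -> smooth_field Y q -> smooth_field (cov nab X Y) q.
Proof. by move=> [sX] [sY]; split; exact: (conn_smooth hnab sX sY). Qed.

Lemma cov_tangent q X Y : smooth_field X q -> smooth_field Y q -> tangent q (cov nab X Y q).
Proof. by move=> sX sY; apply/smooth_field_tangent/cov_smooth. Qed.

Lemma nab_lin q Y a x y : smooth_field Y q -> tangent q x -> tangent q y ->
  nab Y q (a *: x + y) = a *: nab Y q x + nab Y q y.
Proof. by case=> sY; move=> tx ty; exact: (conn_linear hnab a sY tx ty). Qed.

Lemma nab_addv q Y Z x : smooth_field Y q -> smooth_field Z q -> tangent q x ->
  nab (Y + Z) q x = nab Y q x + nab Z q x.
Proof. by move=> [sY] [sZ] tx; exact: (conn_add hnab sY sZ tx). Qed.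

Lemma nab_leibniz q f Y x : smooth_at f q -> smooth_field Y q -> tangent q x ->
  nab (fun r => f r *: Y r) q x = x f *: Y q + f q *: nab Y q x.
Proof. by move=> sf [sY] tx; exact: (conn_leibniz hnab sf sY tx). Qed.

Lemma nab_metric q Y Z x : smooth_field Y q -> smooth_field Z q -> tangent q x ->
  x (fun r => g r (Y r) (Z r)) = g q (nab Y q x) (Z q) + g q (Y q) (nab Z q x).
Proof. by move=> [sY] [sZ] tx; exact: (conn_metric hnab sY sZ tx). Qed.

Lemma lieE q X Y : smooth_field X q -> smooth_field Y q ->
  lie X Y q = cov nab X Y q - cov nab Y X q.
Proof. by move=> [sX] [sY]; rewrite (conn_torsion_free hnab). Qed.

Lemma nab0 q Y : smooth_field Y q -> nab Y q 0 = 0.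
Proof.
move=> sY; have t0 := tangent0 q.
have /eqP := nab_lin 1 sY t0 t0.
by rewrite !scale1r addr0 -subr_eq subrr eq_sym => /eqP.
Qed.

Lemma nabD q Y x y : smooth_field Y q -> tangent q x -> tangent q y ->
  nab Y q (x + y) = nab Y q x + nab Y q y.
Proof. by move=> sY tx ty; have := nab_lin 1 sY tx ty; rewrite !scale1r. Qed.

Lemma nabZ q Y (a : R) x : smooth_field Y q -> tangent q x ->
  nab Y q (a *: x) = a *: nab Y q x.
Proof.
move=> sY tx; have := nab_lin a sY tx (tangent0 q).
by rewrite nab0 // !addr0.
Qed.

Lemma nabB q Y x y : smooth_field Y q -> tangent q x -> tangent q y ->
  nab Y q (x - y) = nab Y q x - nab Y q y.
Proof.
move=> sY tx ty; rewrite nabD //; last exact: tangentN.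
by rewrite -scaleN1r nabZ // scaleN1r.
Qed.

Lemma nab_sum q Y (I : Type) (s : seq I) (x : I -> tvec M) :
  smooth_field Y q -> (forall i, tangent q (x i)) ->
  nab Y q (\sum_(i <- s) x i) = \sum_(i <- s) nab Y q (x i).
Proof.
move=> sY tx; elim: s => [|i s IH]; first by rewrite !big_nil nab0.
by rewrite !big_cons nabD ?IH //; exact: tangent_sum.
Qed.

Lemma nab_scalev q Y (a : R) x : smooth_field Y q -> tangent q x ->
  nab (fun r => a *: Y r) q x = a *: nab Y q x.
Proof.
move=> sY tx; rewrite (nab_leibniz (smooth_at_cst a q) sY tx).
by rewrite (tangent_cst tx) scale0r add0r.
Qed.

(** Locality of the connection, by the same indicator function as in
    [tangent_near]. *)
Lemma nab_near q Y Z x : (\forall r \near q, Y r = Z r) -> smooth_field Y q ->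
  tangent q x -> nab Y q x = nab Z q x.
Proof.
move=> YZ sY tx; have sZ := smooth_field_eq YZ sY.
pose U : vfield M := (fun r => -1 *: Y r) + Z.
have UE r : U r = Z r - Y r by rewrite /U vfieldD scaleN1r addrC.
have sU : smooth_field U q by apply: smooth_fieldD => //; exact: smooth_fieldZc.
have [W [oW Wq] YZW] := near_open_nbhs YZ.
pose chi := fun r => if r \in W then 0 : R else 1.
have schi : smooth_at chi q.
  apply: smooth_at_eq (smooth_at_cst 0 q).
  have : nbhs q W by exact: open_nbhs_nbhs.
  by apply: filterS => r Wr; rewrite /chi mem_set.
have nU : nab U q x = 0.
  have := nab_leibniz schi sU tx.
  have -> : (fun r => chi r *: U r) = U.
    apply/funext => r; rewrite /chi; case: ifPn; last by rewrite scale1r.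
    by move=> /set_mem Wr; rewrite UE YZW // subrr scaler0.
  by rewrite {2}/chi mem_set // UE YZW // subrr scaler0 scale0r addr0.
have <- : U + Y = Z.
  by apply/funext => r; rewrite vfieldD UE subrK.
by rewrite nab_addv // nU add0r.
Qed.

Lemma nab_subv q Y Z x : smooth_field Y q -> smooth_field Z q -> tangent q x ->
  nab (fun r => Y r - Z r) q x = nab Y q x - nab Z q x.
Proof.
move=> sY sZ tx; have -> : (fun r => Y r - Z r) = Y + (fun r => -1 *: Z r).
  by apply/funext => r; rewrite vfieldD scaleN1r.
by rewrite nab_addv ?nab_scalev ?scaleN1r //; exact: smooth_fieldZc.
Qed.

Lemma lie_near q X Y : smooth_field X q -> smooth_field Y q ->
  \forall r \near q, cov nab X Y r - cov nab Y X r = lie X Y r.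
Proof.
move=> /smooth_field_near sX /smooth_field_near.
by apply: filterS2 sX => r sX sY; rewrite lieE.
Qed.

Lemma lie_smooth q X Y : smooth_field X q -> smooth_field Y q -> smooth_field (lie X Y) q.
Proof.
move=> sX sY.
apply: (@smooth_field_eq _ _ _ (fun r => cov nab X Y r - cov nab Y X r) _ _ (lie_near sX sY)).
have := smooth_fieldD (cov_smooth sX sY) (smooth_fieldZc (-1) (cov_smooth sY sX)).
apply: smooth_field_eq; apply: nearW => r.
by rewrite vfieldD scaleN1r.
Qed.

Lemma lie_tangent q X Y : smooth_field X q -> smooth_field Y q -> tangent q (lie X Y q).
Proof. by move=> sX sY; apply/smooth_field_tangent/lie_smooth. Qed.

Lemma hess_tangent q X Y v : smooth_field X q -> smooth_field Y q -> smooth_field v q ->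
  tangent q (hess nab X Y v q).
Proof. by move=> *; apply: tangentB; apply: cov_tangent => //; exact: cov_smooth. Qed.

Lemma curv_hess q X Y v : smooth_field X q -> smooth_field Y q -> smooth_field v q ->
  curv nab X Y v q = hess nab X Y v q - hess nab Y X v q.
Proof.
move=> sX sY sv.
have e : cov nab (lie X Y) v q = cov nab (cov nab X Y) v q - cov nab (cov nab Y X) v q.
  by rewrite {1}/cov lieE // nabB //; exact: cov_tangent.
by rewrite /curv /hess e !opprB addrACA [RHS]addrACA [- _ - _]addrC.
Qed.

Lemma curv_tangent q X Y v : smooth_field X q -> smooth_field Y q -> smooth_field v q ->
  tangent q (curv nab X Y v q).
Proof. by move=> *; rewrite curv_hess //; apply: tangentB; exact: hess_tangent. Qed.

Lemma lie_app q X Y f : smooth_at f q -> lie X Y q f = X q (vapp Y f) - Y q (vapp X f).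
Proof. by rewrite /lie => sf; case: asboolP. Qed.

Lemma lie_junk q X Y f : ~ smooth_at f q -> lie X Y q f = 0.
Proof. by rewrite /lie => nf; case: asboolP => [sf|_]; [case: (nf sf)|]. Qed.

Lemma lie_lie_app q X Y Z f : smooth_field X q -> smooth_field Y q -> smooth_field Z q ->
  smooth_at f q ->
  lie X (lie Y Z) q f =
    X q (vapp Y (vapp Z f)) - X q (vapp Z (vapp Y f))
    - (Y q (vapp Z (vapp X f)) - Z q (vapp Y (vapp X f))).
Proof.
move=> sX sY sZ sf; rewrite lie_app // (lie_app _ _ (smooth_field_app sX sf)); congr (_ - _).
have sYZ := smooth_field_app sY (smooth_field_app sZ sf).
have sZY := smooth_field_app sZ (smooth_field_app sY sf).
have tX := smooth_field_tangent sX.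
rewrite -(tangent_subf tX) //; apply: (tangent_near tX).
by apply: filterS (smooth_at_near sf) => r sfr; rewrite /vapp lie_app.
Qed.

Lemma jacobi q X Y Z : smooth_field X q -> smooth_field Y q -> smooth_field Z q ->
  lie X (lie Y Z) q + lie Y (lie Z X) q + lie Z (lie X Y) q = 0.
Proof.
move=> sX sY sZ; apply/funext => f; rewrite !tvecD.
have [sf|nf] := pselect (smooth_at f q); last first.
  by rewrite !lie_junk // !addr0 tvec0.
by rewrite !lie_lie_app // tvec0; ring.
Qed.

Lemma cov_lie q X Y Z : smooth_field X q -> smooth_field Y q -> smooth_field Z q ->
  cov nab X (lie Y Z) q = cov nab X (cov nab Y Z) q - cov nab X (cov nab Z Y) q.
Proof.
move=> sX sY sZ; have tX := smooth_field_tangent sX; rewrite /cov.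
rewrite -nab_subv //; try exact: cov_smooth.
apply/esym/nab_near => //; first exact: lie_near.
apply: smooth_field_eq (lie_smooth sY sZ).
by apply: filterS (lie_near sY sZ) => r ->.
Qed.

(** Absence of torsion turns the cyclic sum into the cyclic sum of
    D_X [Y,Z] - D_[Y,Z] X = [X,[Y,Z]], which vanishes by the Jacobi identity. *)
Lemma bianchi q X Y Z : smooth_field X q -> smooth_field Y q -> smooth_field Z q ->
  curv nab X Y Z q + curv nab Y Z X q + curv nab Z X Y q = 0.
Proof.
move=> sX sY sZ; rewrite -(jacobi sX sY sZ).
rewrite !lieE //; try exact: lie_smooth.
rewrite !cov_lie // /curv.
set a1 := cov _ X (cov _ Y Z) q; set a2 := cov _ X (cov _ Z Y) q.
set b1 := cov _ Y (cov _ Z X) q; set b2 := cov _ Y (cov _ X Z) q.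
set c1 := cov _ Z (cov _ X Y) q; set c2 := cov _ Z (cov _ Y X) q.
set d1 := cov _ (lie X Y) Z q; set d2 := cov _ (lie Y Z) X q.
set d3 := cov _ (lie Z X) Y q.
by apply/funext => f; rewrite !(tvecD, tvecN); ring.
Qed.

Section Riemann.
Variable F : 'I_m -> vfield M.
Variable q : M.
Hypothesis hF : on_frame g q F.

Lemma metric_fun_smooth X Y : smooth_field X q -> smooth_field Y q ->
  smooth_at (fun r => g r (X r) (Y r)) q.
Proof. exact: (frame_metric_smooth hg hF). Qed.

Lemma second_derivative_metric X Y Z W : smooth_field X q -> smooth_field Y q ->
  smooth_field Z q -> smooth_field W q ->
  X q (vapp Y (fun r => g r (Z r) (W r))) =
    g q (cov nab X (cov nab Y Z) q) (W q) + g q (cov nab Y Z q) (cov nab X W q)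
    + (g q (cov nab X Z q) (cov nab Y W q) + g q (Z q) (cov nab X (cov nab Y W) q)).
Proof.
move=> sX sY sZ sW; have tX := smooth_field_tangent sX.
have sYZ := cov_smooth sY sZ; have sYW := cov_smooth sY sW.
have e1 := nab_metric sYZ sW tX; have e2 := nab_metric sZ sYW tX.
transitivity (X q (fun r => g r (cov nab Y Z r) (W r)) +
              X q (fun r => g r (Z r) (cov nab Y W r))); last by rewrite e1 e2.
rewrite -(tangent_addf tX); try exact: metric_fun_smooth.
apply: (tangent_near tX).
apply: filterS3 (smooth_field_near sY) (smooth_field_near sZ) (smooth_field_near sW) => r sYr sZr sWr.
exact: (nab_metric sZr sWr (smooth_field_tangent sYr)).
Qed.

Lemma riem_antisym12 X Y Z W : smooth_field X q -> smooth_field Y q ->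
  smooth_field Z q -> smooth_field W q ->
  riem g nab X Y Z W q = - riem g nab Y X Z W q.
Proof.
move=> sX sY sZ sW; have tW := smooth_field_tangent sW.
rewrite /riem -(metricNl hg) //; last exact: curv_tangent.
by rewrite !curv_hess // (opprB (hess nab Y X Z q)).
Qed.

Lemma riemE X Y Z W : smooth_field X q -> smooth_field Y q ->
  smooth_field Z q -> smooth_field W q ->
  riem g nab X Y Z W q =
    g q (cov nab X (cov nab Y Z) q) (W q) - g q (cov nab Y (cov nab X Z) q) (W q)
    - g q (cov nab (lie X Y) Z q) (W q).
Proof.
move=> sX sY sZ sW; have tW := smooth_field_tangent sW.
have tXY := cov_tangent sX (cov_smooth sY sZ).
have tYX := cov_tangent sY (cov_smooth sX sZ).
have tL := cov_tangent (lie_smooth sX sY) sZ.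
by rewrite /riem /curv (metricBl hg (tangentB tXY tYX) tL tW) (metricBl hg tXY tYX tW).
Qed.

(** The operator XY - YX - [X,Y] kills the function <Z,W>; expanding it by metric
    compatibility leaves the two curvature terms. *)
Lemma riem_antisym34 X Y Z W : smooth_field X q -> smooth_field Y q ->
  smooth_field Z q -> smooth_field W q ->
  riem g nab X Y Z W q = - riem g nab X Y W Z q.
Proof.
move=> sX sY sZ sW; have sg := metric_fun_smooth sZ sW.
have tZ := smooth_field_tangent sZ.
have e := lie_app X Y sg.
rewrite (nab_metric sZ sW (lie_tangent sX sY)) in e.
rewrite (second_derivative_metric sX) // (second_derivative_metric sY) // in e.
rewrite (bilinear_sym hg tZ (cov_tangent (lie_smooth sX sY) sW)) in e.
rewrite (bilinear_sym hg tZ (cov_tangent sX (cov_smooth sY sW))) in e.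
rewrite (bilinear_sym hg tZ (cov_tangent sY (cov_smooth sX sW))) in e.
rewrite -/(cov nab (lie X Y) Z q) in e.
rewrite !riemE //; move: e.
move: (g q (cov nab Y Z q) (cov nab X W q)) (g q (cov nab X Z q) (cov nab Y W q)).
move: (g q (cov nab X (cov nab Y Z) q) (W q)) (g q (cov nab Y (cov nab X Z) q) (W q)).
move: (g q (cov nab X (cov nab Y W) q) (Z q)) (g q (cov nab Y (cov nab X W) q) (Z q)).
move: (g q (cov nab (lie X Y) Z q) (W q)) (g q (cov nab (lie X Y) W q) (Z q)).
by move=> a1 a2 b1 b2 c1 c2 d1 d2; lra.
Qed.

Lemma riem_bianchi X Y Z W : smooth_field X q -> smooth_field Y q ->
  smooth_field Z q -> smooth_field W q ->
  riem g nab X Y Z W q + riem g nab Y Z X W q + riem g nab Z X Y W q = 0.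
Proof.
move=> sX sY sZ sW; have tW := smooth_field_tangent sW.
rewrite /riem -!(metricDl hg) //; try (exact: curv_tangent);
  try (by apply: tangentD; exact: curv_tangent).
by rewrite bianchi // (metric0l hg).
Qed.

(** The octahedron argument: the sum of the four cyclic identities, in which the
    antisymmetries cancel all components but two, each of which occurs twice. *)
Lemma riem_pair X Y Z W : smooth_field X q -> smooth_field Y q ->
  smooth_field Z q -> smooth_field W q ->
  riem g nab X Y Z W q = riem g nab Z W X Y q.
Proof.
move=> sX sY sZ sW.
have b1 := riem_bianchi sY sZ sX sW; have b2 := riem_bianchi sZ sX sW sY.
have b3 := riem_bianchi sX sW sY sZ; have b4 := riem_bianchi sW sY sZ sX.
have e1 := riem_antisym34 sZ sX sW sY; have e2 := riem_antisym34 sX sW sY sZ.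
have e3 : riem g nab Y X W Z q = riem g nab X Y Z W q.
  by rewrite riem_antisym12 // riem_antisym34 // opprK.
have e4 := riem_antisym34 sW sY sZ sX; have e5 := riem_antisym34 sY sZ sW sX.
have e6 := riem_antisym12 sW sZ sX sY; have e7 := riem_antisym34 sZ sW sY sX.
(* Six components remain; b1 + b2 + b3 + b4 is then twice the
   difference of the two sides. *)
rewrite e1 e6 in b2; rewrite e2 e3 in b3; rewrite e4 e5 e7 in b4.
move: (riem g nab Y Z X W q) (riem g nab Z X Y W q) (riem g nab X Y Z W q)
  (riem g nab X W Z Y q) (riem g nab Z W X Y q) (riem g nab W Y X Z q) b1 b2 b3 b4.
by move=> a1 a2 a3 a4 a5 a6; lra.
Qed.

Lemma ric_sym X Y : smooth_field X q -> smooth_field Y q ->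
  ric g nab F X Y q = ric g nab F Y X q.
Proof.
move=> sX sY; apply: eq_bigr => a _; have sF := frame_smooth hF a.
by rewrite riem_pair // riem_antisym12 // riem_antisym34 // opprK.
Qed.

End Riemann.
End LeviCivitaCalculus.

(** * Weitzenboeck formulas *)

Section Weitzenboeck.
Variables (R : realType) (m : nat) (M : manifold R m) (g : metric M).
Variable nab : connection M.
Hypotheses (hg : bilinear_metric g) (hnab : levi_civita g nab).
Variables (F : 'I_m -> vfield M) (q : M).
Hypothesis hF : on_frame g q F.
Implicit Types (x y z : tvec M) (X Y Z W v : vfield M) (t : form2 M).

Let sF a : smooth_field (F a) q := frame_smooth hF a.
Let tF a : tangent q (F a q) := frame_tangent hF a.

(** Differentiate <F_a,F_c>, which is constant. *)
Lemma frame_connection_antisym a c x : tangent q x ->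
  g q (nab (F a) q x) (F c q) = - g q (nab (F c) q x) (F a q).
Proof.
move=> tx; have := nab_metric hnab (sF a) (sF c) tx.
rewrite (@tangent_near _ _ _ _ _ tx _ (fun=> (a == c)%:R)); last first.
  by apply: filterS (on_frame_near hF) => r hFr; rewrite (frame_orthonormal hFr).
rewrite (tangent_cst tx) (bilinear_sym hg (tF a)); last exact: (nab_tangent hnab).
by move/esym/eqP; rewrite addr_eq0 => /eqP.
Qed.

(** The antisymmetric matrix <D_Y F_a, F_c> is contracted with the bilinear form
    <D_x v, y>; moving it from one slot to the other changes the sign. *)
Lemma frame_derivative_trace v Y : smooth_field v q -> smooth_field Y q ->
  \sum_a g q (nab v q (F a q)) (cov nab Y (F a) q) =
  - \sum_a g q (nab v q (cov nab Y (F a) q)) (F a q).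
Proof.
move=> sv sY; have tY := smooth_field_tangent sY.
pose G a c := g q (nab (F a) q (Y q)) (F c q).
pose B a c := g q (nab v q (F a q)) (F c q).
have tv a : tangent q (nab v q (F a q)) by exact: (nab_tangent hnab).
have tc a : tangent q (cov nab Y (F a) q) by exact: (cov_tangent hnab).
have -> : \sum_a g q (nab v q (F a q)) (cov nab Y (F a) q) =
    \sum_a \sum_c G a c * B a c.
  apply: eq_bigr => a _; rewrite (frame_parseval hg hF) //.
  by apply: eq_bigr => c _; rewrite mulrC.
have -> : \sum_a g q (nab v q (cov nab Y (F a) q)) (F a q) =
    \sum_a \sum_c G a c * B c a.
  apply: eq_bigr => a _; rewrite {1}(frame_expand hg hF (tc a)).
  have tZ c : tangent q (g q (cov nab Y (F a) q) (F c q) *: F c q) by exact: tangentZ.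
  rewrite (nab_sum hnab) // (metric_suml hg) //; last first.
    by move=> c; apply: (nab_tangent hnab).
  by apply: eq_bigr => c _; rewrite (nabZ hnab) // (metricZl hg).
rewrite exchange_big /= -sumrN; apply: eq_bigr => a _.
rewrite -sumrN; apply: eq_bigr => c _.
by rewrite /G (frame_connection_antisym c a tY) mulNr.
Qed.

Lemma div_smooth v : smooth_field v q -> smooth_at (div g nab F v) q.
Proof.
move=> sv; apply: smooth_at_sum => a.
exact: (metric_fun_smooth hg hF (cov_smooth hnab (sF a) sv) (sF a)).
Qed.

(** Differentiating the trace also differentiates F_a in the second slot; by
    [frame_derivative_trace] this term is the correction that makes the second
    derivative tensorial. *)
Lemma derivative_div v Y : smooth_field v q -> smooth_field Y q ->
  Y q (div g nab F v) = \sum_a g q (hess nab Y (F a) v q) (F a q).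
Proof.
move=> sv sY; have tY := smooth_field_tangent sY.
have sFv a : smooth_field (cov nab (F a) v) q by exact: (cov_smooth hnab).
rewrite (tangent_sumf tY); last first.
  by move=> a; exact: (metric_fun_smooth hg hF (sFv a) (sF a)).
have e a : Y q (fun r => g r (nab v r (F a r)) (F a r)) =
    g q (cov nab Y (cov nab (F a) v) q) (F a q)
    + g q (nab v q (F a q)) (cov nab Y (F a) q).
  exact: (nab_metric hnab (sFv a) (sF a) tY).
rewrite (eq_bigr _ (fun a _ => e a)) big_split /= frame_derivative_trace //.
rewrite -sumrN -big_split; apply: eq_bigr => a _ /=.
by rewrite (metricBl hg) //; apply: (cov_tangent hnab) => //; exact: (cov_smooth hnab).
Qed.

Lemma eq_div_form2 v t t' Y : smooth_field v q -> smooth_field Y q ->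
  (forall r X Z, smooth_field v r -> smooth_field X r -> smooth_field Z r ->
     t X Z r = t' X Z r) ->
  div_form2 nab F t Y q = div_form2 nab F t' Y q.
Proof.
move=> sv sY tt'; apply: eq_bigr => a _; rewrite /cov_form2.
have sFF : smooth_field (cov nab (F a) (F a)) q by exact: (cov_smooth hnab).
have sFY : smooth_field (cov nab (F a) Y) q by exact: (cov_smooth hnab).
congr (_ - _ - _); [|exact: tt'|exact: tt'].
apply: (tangent_near (tF a)).
apply: filterS3 (smooth_field_near sv) (smooth_field_near sY)
  (smooth_field_near (sF a)) => r svr sYr sFr.
exact: tt'.
Qed.

(** The deformation tensor is the case c = 1/2, e = 1 and the exterior derivative
    of the 1-form dual to v is the case c = 1, e = -1.  Expanding by metric
    compatibility, the derivatives of F_a and Y cancel or complete a Hessian. *)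
Lemma div_form2_nab (c e : R) v Y : smooth_field v q -> smooth_field Y q ->
  div_form2 nab F (fun X Z r =>
    c * (g r (nab v r (X r)) (Z r) + e * g r (nab v r (Z r)) (X r))) Y q =
  c * \sum_a (g q (second_cov nab (F a) v q) (Y q)
              + e * g q (hess nab (F a) Y v q) (F a q)).
Proof.
move=> sv sY; have tY := smooth_field_tangent sY.
rewrite /div_form2 mulr_sumr; apply: eq_bigr => a _; rewrite /cov_form2.
have sFv : smooth_field (cov nab (F a) v) q by exact: (cov_smooth hnab).
have sYv : smooth_field (cov nab Y v) q by exact: (cov_smooth hnab).
have sFF : smooth_field (cov nab (F a) (F a)) q by exact: (cov_smooth hnab).
have sFY : smooth_field (cov nab (F a) Y) q by exact: (cov_smooth hnab).
have s1 := metric_fun_smooth hg hF sFv sY.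
have s2 := metric_fun_smooth hg hF sYv (sF a).
rewrite (tangent_scalef (tF a)); last exact: (smooth_atD s1 (smooth_atZ e s2)).
rewrite (tangent_addf (tF a) s1 (smooth_atZ e s2)) (tangent_scalef (tF a) e s2).
rewrite (nab_metric hnab sFv sY (tF a)) (nab_metric hnab sYv (sF a) (tF a)).
rewrite /second_cov /hess.
have ct A B (sA : smooth_field A q) (sB : smooth_field B q) := cov_tangent hnab sA sB.
rewrite (metricBl hg (ct _ _ (sF a) sFv) (ct _ _ sFF sv) tY).
rewrite (metricBl hg (ct _ _ (sF a) sYv) (ct _ _ sFY sv) (tF a)).
rewrite /cov; ring.
Qed.

Lemma d1_flat v X Y r : smooth_field v r -> smooth_field X r -> smooth_field Y r ->
  d1 (flat g v) X Y r =
  1 * (g r (nab v r (X r)) (Y r) + -1 * g r (nab v r (Y r)) (X r)).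
Proof.
move=> sv sX sY; have tX := smooth_field_tangent sX; have tY := smooth_field_tangent sY.
have tv := smooth_field_tangent sv.
rewrite /d1 /flat (nab_metric hnab sv sY tX) (nab_metric hnab sv sX tY).
rewrite (lieE hnab) // !(bilinear_sym hg tv);
  try (by apply: tangentB; exact: (cov_tangent hnab)); try exact: (nab_tangent hnab).
rewrite (metricBl hg) //; try exact: (cov_tangent hnab).
by rewrite /cov; ring.
Qed.

Lemma codiff1_flat v r : smooth_field v r -> on_frame g r F ->
  codiff1 nab F (flat g v) r = - div g nab F v r.
Proof.
move=> sv hFr; congr (- _); apply: eq_bigr => a _.
have sFr := frame_smooth hFr a; have tFr := frame_tangent hFr a.
by rewrite /cov_form1 /flat (nab_metric hnab sv sFr tFr) addrK.
Qed.

(** Commuting the two derivatives produces the gradient of the divergence and the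
    Ricci curvature. *)
Lemma hess_trace v b : smooth_field v q ->
  \sum_a g q (hess nab (F a) (F b) v q) (F a q) =
  F b q (div g nab F v) + ric g nab F (F b) v q.
Proof.
move=> sv; rewrite derivative_div // -big_split; apply: eq_bigr => a _ /=.
rewrite /riem (curv_hess hnab) // (metricBl hg) //; try exact: (hess_tangent hnab).
by rewrite addrC subrK.
Qed.

Lemma bochner_laplacian_comp v : smooth_field v q ->
  bochner_laplacian nab F v q =
  \sum_b (- \sum_a g q (second_cov nab (F a) v q) (F b q)) *: F b q.
Proof.
move=> sv.
have ts a : tangent q (second_cov nab (F a) v q) by exact: (hess_tangent hnab).
rewrite /bochner_laplacian {1}(frame_expand hg hF (tangent_sum _ _ ts)) -sumrN.
by apply: eq_bigr => b _; rewrite (metric_suml hg) // scaleNr.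
Qed.

Lemma deformation_laplacian_comp v : smooth_field v q ->
  deformation_laplacian g nab F v q =
  \sum_b (- (\sum_a g q (second_cov nab (F a) v q) (F b q))
          - F b q (div g nab F v) - ric g nab F (F b) v q) *: F b q.
Proof.
move=> sv; rewrite /deformation_laplacian /sharp scaler_sumr.
apply: eq_bigr => b _; rewrite scalerA; congr (_ *: _).
rewrite (@eq_div_form2 v _ (fun X Z r =>
  2^-1 * (g r (nab v r (X r)) (Z r) + 1 * g r (nab v r (Z r)) (X r)))) //; last first.
  by move=> r X Z _ _ _; rewrite mul1r.
rewrite div_form2_nab // big_split /= -mulr_sumr mul1r hess_trace // mulrA mulNr mulfV //.
by rewrite mulN1r !opprD !addrA.
Qed.

Lemma ricv_comp v : smooth_field v q ->
  ricv g nab F v q = \sum_b ric g nab F (F b) v q *: F b q.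
Proof.
by move=> sv; apply: eq_bigr => b _; rewrite (ric_sym hg hnab hF).
Qed.

Lemma hodge_laplacian_comp v : smooth_field v q ->
  hodge_laplacian g nab F v q =
  \sum_b (- (\sum_a g q (second_cov nab (F a) v q) (F b q))
          + ric g nab F (F b) v q) *: F b q.
Proof.
move=> sv; apply: eq_bigr => b _; congr (_ *: _).
rewrite /codiff2 (@eq_div_form2 v _ (fun X Z r =>
  1 * (g r (nab v r (X r)) (Z r) + -1 * g r (nab v r (Z r)) (X r)))) //; last first.
  by move=> r X Z *; exact: d1_flat.
rewrite div_form2_nab // big_split /= -mulr_sumr hess_trace // /d0.
have sdiv := div_smooth sv.
have -> : F b q (codiff1 nab F (flat g v)) = - F b q (div g nab F v).
  rewrite -(tangent_oppf (tF b) sdiv); apply: (tangent_near (tF b)).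
  apply: filterS2 (smooth_field_near sv) (on_frame_near hF) => r svr hFr.
  exact: codiff1_flat.
by ring.
Qed.

End Weitzenboeck.

(** * Extensions of fields and the Gauss formula *)

Section TangentMap.
Variables (R : realType) (n n' : nat) (M : manifold R n) (M' : manifold R n').
Variables (iota : M -> M') (hiota : embedding iota).
Implicit Types (q : M) (x y z : tvec M).

Local Notation tm := (tangent_map iota).

Lemma tangent_mapE q x f : smooth_at f (iota q) -> tm q x f = x (f \o iota).
Proof. by rewrite /tangent_map => sf; case: asboolP. Qed.

Lemma tangent_map_tangent q x : tangent q x -> tangent (iota q) (tm q x).
Proof.
move=> [xl xm xj]; have es := emb_smooth hiota.
split=> [a f h sf sh|f h sf sh|f nf].
- rewrite (tangent_mapE x (smooth_atD (smooth_atZ a sf) sh)).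
  rewrite (tangent_mapE x sf) (tangent_mapE x sh).
  exact: (xl a _ _ (es _ _ sf) (es _ _ sh)).
- rewrite (tangent_mapE x (smooth_atM sf sh)) (tangent_mapE x sf) (tangent_mapE x sh).
  exact: (xm _ _ (es _ _ sf) (es _ _ sh)).
- by rewrite /tangent_map; case: asboolP => [sf|_]; [case: (nf sf)|].
Qed.

Lemma tangent_mapD q x y : tm q (x + y) = tm q x + tm q y.
Proof.
apply/funext => f; rewrite tvecD /tangent_map; case: asboolP => _ //.
by rewrite addr0.
Qed.

Lemma tangent_mapZ q (a : R) x : tm q (a *: x) = a *: tm q x.
Proof.
apply/funext => f; rewrite tvecZ /tangent_map; case: asboolP => _ //.
by rewrite mulr0.
Qed.

Lemma tangent_map0 q : tm q 0 = 0.
Proof. by apply/funext => f; rewrite tvec0 /tangent_map; case: asboolP. Qed.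

Lemma tangent_map_sum q (I : Type) (s : seq I) (x : I -> tvec M) :
  tm q (\sum_(i <- s) x i) = \sum_(i <- s) tm q (x i).
Proof.
elim: s => [|i s IH]; first by rewrite !big_nil tangent_map0.
by rewrite !big_cons tangent_mapD IH.
Qed.

Lemma near_embedding q (P : M' -> Prop) :
  (\forall s \near iota q, P s) -> \forall r \near q, P (iota r).
Proof. by move=> nP; exact: (emb_continuous hiota) nP. Qed.

Record field_extension (v' : vfield M') (v : vfield M) q : Prop := FieldExtension {
  extension_smooth : smooth_field v' (iota q);
  extended_smooth : smooth_field v q;
  extension_along : \forall r \near q, v' (iota r) = tm r (v r) }.

Lemma field_extension_near v' v q : field_extension v' v q ->
  \forall r \near q, field_extension v' v r.
Proof.
move=> [sv' sv vv'].
apply: filterS3 (near_embedding (smooth_field_near sv')) (smooth_field_near sv)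
  (near_join vv') => r ? ? ?; by split.
Qed.

Lemma extensionE v' v q : field_extension v' v q -> v' (iota q) = tm q (v q).
Proof. by move=> [_ _ /nbhs_singleton]. Qed.

(** Both sides act on f through f restricted to M: along M, the derivative of f by
    an extension of Y is the derivative of f o iota by Y. *)
Lemma lie_extension X' Y' X Y q : field_extension X' X q -> field_extension Y' Y q ->
  lie X' Y' (iota q) = tm q (lie X Y q).
Proof.
move=> eX eY.
have sX := extended_smooth eX; have sY := extended_smooth eY.
have main A' B' A B f : field_extension A' A q -> field_extension B' B q ->
    smooth_at f (iota q) -> A' (iota q) (vapp B' f) = A q (vapp B (f \o iota)).
  move=> eA eB sf; have sBf := smooth_field_app (extension_smooth eB) sf.
  rewrite (extensionE eA) tangent_mapE //.
  apply: (tangent_near (smooth_field_tangent (extended_smooth eA))).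
  apply: filterS2 (extension_along eB) (near_embedding (smooth_at_near sf)) => r BB sfr.
  by rewrite /vapp /= BB tangent_mapE.
apply/funext => f; rewrite /tangent_map; case: asboolP => sf; last first.
  by rewrite /lie; case: asboolP.
rewrite (lie_app _ _ sf) (lie_app _ _ (emb_smooth hiota sf)).
by rewrite (main _ _ _ _ _ eX eY sf) (main _ _ _ _ _ eY eX sf).
Qed.

Variables (g' : metric M') (hg' : riemannian g').
Local Notation g := (induced_metric iota g').

Lemma riemannian_bilinear : bilinear_metric g'.
Proof.
split=> [q x y|q a x y z]; first exact: (Defs.metric_sym hg').
exact: (metric_linear hg').
Qed.

Lemma induced_bilinear : bilinear_metric g.
Proof.
split=> [q x y tx ty|q a x y z tx ty tz]; rewrite /induced_metric.
  by apply: (Defs.metric_sym hg'); exact: tangent_map_tangent.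
rewrite tangent_mapD tangent_mapZ; apply: (metric_linear hg');
  exact: tangent_map_tangent.
Qed.

Variables (nab' : connection M') (hnab' : levi_civita g' nab').
Variables (nab : connection M) (hnab : levi_civita g nab).

Lemma ambient_metric_smooth X' Y' q :
  smooth_field X' (iota q) -> smooth_field Y' (iota q) ->
  smooth_at (fun s => g' s (X' s) (Y' s)) (iota q).
Proof. by move=> [sX] [sY]; exact: (metric_smooth hg' sX sY). Qed.

(** Both sides are the derivative along x of the same function <Y,Z> on M. *)
Lemma metric_along Y' Z' Y Z q x : tangent q x ->
  field_extension Y' Y q -> field_extension Z' Z q ->
  g' (iota q) (nab' Y' (iota q) (tm q x)) (Z' (iota q))
    + g' (iota q) (Y' (iota q)) (nab' Z' (iota q) (tm q x)) =
  g q (nab Y q x) (Z q) + g q (Y q) (nab Z q x).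
Proof.
move=> tx eY eZ.
have [sY' sY YY] := eY; have [sZ' sZ ZZ] := eZ.
rewrite -(nab_metric hnab sY sZ tx).
rewrite -(nab_metric hnab' sY' sZ' (tangent_map_tangent tx)).
rewrite tangent_mapE; last exact: ambient_metric_smooth.
by apply: (tangent_near tx); apply: filterS2 YY ZZ => r /= -> ->.
Qed.

Lemma torsion_along X' Y' Z' X Y Z q :
  field_extension X' X q -> field_extension Y' Y q -> field_extension Z' Z q ->
  g' (iota q) (cov nab' X' Y' (iota q)) (Z' (iota q))
    - g' (iota q) (cov nab' Y' X' (iota q)) (Z' (iota q)) =
  g q (cov nab X Y q) (Z q) - g q (cov nab Y X q) (Z q).
Proof.
move=> eX eY eZ; have [sX' sX XX] := eX; have [sY' sY YY] := eY; have [sZ' sZ ZZ] := eZ.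
have hb' := riemannian_bilinear; have hb := induced_bilinear.
rewrite -(metricBl hb') -?(metricBl hb); try exact: smooth_field_tangent;
  try (by apply: (cov_tangent hnab)); try (by apply: (cov_tangent hnab')).
rewrite -(lieE hnab') // -(lieE hnab) // (lie_extension eX eY) (extensionE eZ).
by [].
Qed.

(** Uniqueness of the Levi-Civita connection: the difference S(X,Y,Z) of the two
    sides is antisymmetric in Y, Z by [metric_along] and symmetric in X, Y by
    [torsion_along], hence zero. *)
Lemma gauss_formula X' Y' Z' X Y Z q :
  field_extension X' X q -> field_extension Y' Y q -> field_extension Z' Z q ->
  g' (iota q) (cov nab' X' Y' (iota q)) (Z' (iota q)) = g q (cov nab X Y q) (Z q).
Proof.
have hb' := riemannian_bilinear; have hb := induced_bilinear.
pose S' A' B' C' := g' (iota q) (cov nab' A' B' (iota q)) (C' (iota q)).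
pose S A B C := g q (cov nab A B q) (C q).
have antisym A' B' C' A B C : field_extension A' A q -> field_extension B' B q ->
    field_extension C' C q -> S' A' B' C' + S' A' C' B' = S A B C + S A C B.
  move=> eA eB eC; have [sA' sA _] := eA; have [sB' sB _] := eB; have [sC' sC _] := eC.
  have := metric_along (smooth_field_tangent sA) eB eC.
  rewrite -(extensionE eA).
  rewrite [g' _ (B' _) _](bilinear_sym hb'); last 2 first.
    exact: smooth_field_tangent. exact: (cov_tangent hnab').
  rewrite [g _ (B _) _](bilinear_sym hb) //; last 2 first.
    exact: smooth_field_tangent. exact: (cov_tangent hnab).
move=> eX eY eZ.
have a1 := antisym _ _ _ _ _ _ eX eY eZ; have a2 := antisym _ _ _ _ _ _ eY eZ eX.
have a3 := antisym _ _ _ _ _ _ eZ eX eY.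
have t1 := torsion_along eX eY eZ; have t2 := torsion_along eY eZ eX.
have t3 := torsion_along eZ eX eY.
rewrite -/(S' _ _ _) -/(S _ _ _).
rewrite -/(S' X' Y' Z') -/(S' Y' X' Z') -/(S X Y Z) -/(S Y X Z) in t1.
rewrite -/(S' Y' Z' X') -/(S' Z' Y' X') -/(S Y Z X) -/(S Z Y X) in t2.
rewrite -/(S' Z' X' Y') -/(S' X' Z' Y') -/(S Z X Y) -/(S X Z Y) in t3.
move: (S' X' Y' Z') (S' X' Z' Y') (S' Y' X' Z') (S' Y' Z' X') (S' Z' X' Y') (S' Z' Y' X')
  (S X Y Z) (S X Z Y) (S Y X Z) (S Y Z X) (S Z X Y) (S Z Y X) a1 a2 a3 t1 t2 t3.
by move=> a1 a2 a3 a4 a5 a6 b1 b2 b3 b4 b5 b6; lra.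
Qed.

End TangentMap.

(** * Adapted frames and the second fundamental form *)

Section Submanifolds.
Variables (R : realType) (n k : nat) (M : manifold R n) (M' : manifold R (n + k)).
Variables (iota : M -> M') (hiota : embedding iota).
Variables (g' : metric M') (hg' : riemannian g').
Variables (nab' : connection M') (hnab' : levi_civita g' nab').
Local Notation g := (induced_metric iota g').
Variables (nab : connection M) (hnab : levi_civita g nab).
Variables (E : 'I_n -> vfield M) (F : 'I_(n + k) -> vfield M').
Implicit Types (q : M) (x y z : tvec M).
Local Notation tm := (tangent_map iota).
Local Notation ext := (field_extension iota).
Local Notation E' := (fun i : 'I_n => F (lshift k i)).
Local Notation N := (fun l : 'I_k => F (rshift n l)).

Let hb' : bilinear_metric g' := riemannian_bilinear hg'.
Let hb : bilinear_metric g := induced_bilinear hiota hg'.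
Let tm_tangent q x : tangent q x -> tangent (iota q) (tm q x) :=
  @tangent_map_tangent _ _ _ _ _ _ hiota q x.

(** Bundled at a single point because the Gauss formula is applied at all nearby
    points before differentiating; see [adapted_frames_near]. *)
Record adapted_frames q : Prop := AdaptedFrames {
  adapted_intrinsic : on_frame g q E;
  adapted_ambient : on_frame g' (iota q) F;
  adapted_along : \forall r \near q, forall i : 'I_n, F (lshift k i) (iota r) = tm r (E i r) }.

Lemma adapted_frames_near q : adapted_frames q -> \forall r \near q, adapted_frames r.
Proof.
move=> [hE hF hEF].
apply: filterS3 (on_frame_near hE) (near_embedding hiota (on_frame_near hF))
  (near_join hEF) => r ? ? ?; by split.
Qed.

Section AtPoint.
Variable q : M.
Hypothesis hA : adapted_frames q.
Let hE := adapted_intrinsic hA.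
Let hF := adapted_ambient hA.
Let sF a : smooth_field (F a) (iota q) := frame_smooth hF a.
Let tF a : tangent (iota q) (F a (iota q)) := frame_tangent hF a.
Let tE i : tangent q (E i q) := frame_tangent hE i.

Lemma frame_extension i : ext (F (lshift k i)) (E i) q.
Proof.
split; [exact: sF|exact: (frame_smooth hE)|].
by apply: filterS (adapted_along hA) => r; apply.
Qed.

Lemma metric_tangent_map x i : tangent q x ->
  g' (iota q) (tm q x) (F (lshift k i) (iota q)) = g q x (E i q).
Proof. by rewrite (extensionE (frame_extension i)). Qed.

Lemma metric_tangent_normal x l : tangent q x ->
  g' (iota q) (tm q x) (F (rshift n l) (iota q)) = 0.
Proof.
move=> tx; rewrite (frame_expand hb hE tx) tangent_map_sum (metric_suml hb') //; last first.
  by move=> i; apply: tm_tangent; exact: tangentZ.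
rewrite big1 // => i _; rewrite tangent_mapZ (metricZl hb') //; last exact: tm_tangent.
by rewrite -(extensionE (frame_extension i)) (frame_orthonormal hF) eq_lrshift mulr0.
Qed.

Lemma ambient_parseval (x y : tvec M') : tangent (iota q) x -> tangent (iota q) y ->
  g' (iota q) x y =
  \sum_i g' (iota q) x (E' i (iota q)) * g' (iota q) y (E' i (iota q)) +
  \sum_l g' (iota q) x (N l (iota q)) * g' (iota q) y (N l (iota q)).
Proof. by move=> tx ty; rewrite (frame_parseval hb' hF) // big_split_ord. Qed.

Lemma ambient_ext (x y : tvec M') : tangent (iota q) x -> tangent (iota q) y ->
  (forall i, g' (iota q) x (E' i (iota q)) = g' (iota q) y (E' i (iota q))) ->
  (forall l, g' (iota q) x (N l (iota q)) = g' (iota q) y (N l (iota q))) -> x = y.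
Proof.
move=> tx ty xyE xyN; apply: (frame_ext hb' hF) => // a.
by case: (splitP a) => j aj; [have -> : a = lshift k j by apply: val_inj|
  have -> : a = rshift n j by apply: val_inj].
Qed.

(** The combination of the E_i on the right has the orthogonality property that
    defines the projection, and a tangent vector of M with this property has these
    coefficients. *)
Lemma tproj_comp (x : tvec M') : tangent (iota q) x ->
  tproj iota g' q x = \sum_i g' (iota q) x (E' i (iota q)) *: E i q.
Proof.
move=> tx; set y := (RHS).
have ty : tangent q y by exact: (frame_sum_tangent hE).
have orth (y0 : tvec M) i : tangent q y0 ->
    g' (iota q) (x - tm q y0) (tm q (E i q)) =
    g' (iota q) x (E' i (iota q)) - g q y0 (E i q).
  move=> ty0; rewrite (metricBl hb' tx); try exact: tm_tangent.
  by rewrite -(metric_tangent_map _ ty0) (extensionE (frame_extension i)).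
rewrite /tproj; case: xgetP => [y0 _ [ty0 hy0]|/(_ y) []]; last first.
  split=> // z tz; rewrite (frame_expand hb hE tz).
  rewrite (tangent_map_sum _ _ _ (fun i => g q z (E i q) *: E i q)).
  have tD : tangent (iota q) (x - tm q y) by apply: tangentB => //; exact: tm_tangent.
  rewrite (metric_sumr hb') //; last first.
    by move=> i; apply: tm_tangent; exact: tangentZ.
  rewrite big1 // => i _; rewrite tangent_mapZ (metricZr hb') ?orth //; last exact: tm_tangent.
  by rewrite /y (frame_comp hb hE) subrr mulr0.
rewrite (frame_expand hb hE ty0); apply: eq_bigr => i _; congr (_ *: _).
by have /eqP := hy0 _ (tE i); rewrite orth // subr_eq0 => /eqP.
Qed.

Lemma tproj_tangent (x : tvec M') : tangent (iota q) x -> tangent q (tproj iota g' q x).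
Proof. by move=> tx; rewrite tproj_comp //; exact: (frame_sum_tangent hE). Qed.

Lemma metric_tproj (x : tvec M') i : tangent (iota q) x ->
  g q (tproj iota g' q x) (E i q) = g' (iota q) x (E' i (iota q)).
Proof. by move=> tx; rewrite tproj_comp // (frame_comp hb hE). Qed.

Lemma tproj_frame_sum (c : 'I_(n + k) -> R) :
  tproj iota g' q (\sum_a c a *: F a (iota q)) = \sum_i c (lshift k i) *: E i q.
Proof.
rewrite tproj_comp; last exact: (frame_sum_tangent hF).
by apply: eq_bigr => i _; rewrite (frame_comp hb' hF).
Qed.

Lemma nproj_tangent (x : tvec M') : tangent (iota q) x -> tangent (iota q) (nproj iota g' q x).
Proof. by move=> tx; apply: tangentB => //; apply: tm_tangent; exact: tproj_tangent. Qed.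

Lemma metric_nproj_tangent (x : tvec M') i : tangent (iota q) x ->
  g' (iota q) (nproj iota g' q x) (E' i (iota q)) = 0.
Proof.
move=> tx; have tT := tproj_tangent tx; rewrite (metricBl hb') //; last exact: tm_tangent.
by rewrite metric_tangent_map // metric_tproj // subrr.
Qed.

Lemma metric_nproj_normal (x : tvec M') l : tangent (iota q) x ->
  g' (iota q) (nproj iota g' q x) (N l (iota q)) = g' (iota q) x (N l (iota q)).
Proof.
move=> tx; have tT := tproj_tangent tx; rewrite (metricBl hb') //; last exact: tm_tangent.
by rewrite metric_tangent_normal // subr0.
Qed.

Lemma tangent_of_normal_zero (x : tvec M') : tangent (iota q) x ->
  (forall l, g' (iota q) x (N l (iota q)) = 0) -> tm q (tproj iota g' q x) = x.
Proof.
move=> tx xN; have tT := tproj_tangent tx.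
apply: ambient_ext => //; first exact: tm_tangent.
  by move=> i; rewrite metric_tangent_map // metric_tproj.
by move=> l; rewrite metric_tangent_normal // xN.
Qed.

(** Both sides are linear in x, so [gauss_formula] for X = E_i suffices. *)
Lemma tproj_nab v' v x : ext v' v q -> tangent q x ->
  tproj iota g' q (nab' v' (iota q) (tm q x)) = nab v q x.
Proof.
move=> ev tx; have sv' := extension_smooth ev; have sv := extended_smooth ev.
have tn : tangent (iota q) (nab' v' (iota q) (tm q x)).
  by apply: (nab_tangent hnab') => //; exact: tm_tangent.
apply: (frame_ext hb hE); [exact: tproj_tangent|exact: (nab_tangent hnab)|move=> j].
rewrite metric_tproj // (frame_expand hb hE tx) tangent_map_sum.
have tZ i : tangent q (g q x (E i q) *: E i q) by exact: tangentZ.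
rewrite (nab_sum hnab') //; last by move=> i; exact: tm_tangent.
rewrite (nab_sum hnab) // (metric_suml hb') //; last first.
  by move=> i; apply: (nab_tangent hnab') => //; exact: tm_tangent.
rewrite (metric_suml hb) //; last by move=> i; exact: (nab_tangent hnab).
apply: eq_bigr => i _; have tmE : tangent (iota q) (tm q (E i q)) by exact: tm_tangent.
rewrite tangent_mapZ (nabZ hnab') // (nabZ hnab) // (metricZl hb') //; last first.
  exact: (nab_tangent hnab').
rewrite (metricZl hb) //; last exact: (nab_tangent hnab).
congr (_ * _); rewrite -(extensionE (frame_extension i)).
exact: (gauss_formula hiota hg' hnab' hnab (frame_extension i) ev (frame_extension j)).
Qed.

(** For X' and v' tangent along M this is b_l(X,v), with b_l the component of the
    second fundamental form along N_l. *)
Definition normal_part (X' v' : vfield M') l : R :=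
  g' (iota q) (cov nab' X' v' (iota q)) (N l (iota q)).

(** The difference is the normal component of a bracket of fields tangent to M. *)
Lemma normal_part_sym X' Y' X Y l : ext X' X q -> ext Y' Y q ->
  normal_part X' Y' l = normal_part Y' X' l.
Proof.
move=> eX eY; have [sX' sX _] := eX; have [sY' sY _] := eY.
apply/eqP; rewrite -subr_eq0 /normal_part -(metricBl hb') //;
  try exact: (cov_tangent hnab').
rewrite -(lieE hnab') // (lie_extension hiota eX eY) metric_tangent_normal //.
exact: (lie_tangent hnab).
Qed.

(** Along M the function <D'_Y v, E_j'> equals <D_Y v, E_j>.  Differentiate both by
    X and subtract: <D'_Y v, D'_X E_j'> exceeds its intrinsic counterpart by the
    product of the normal parts. *)
Lemma gauss_second X' Y' v' X Y v j : ext X' X q -> ext Y' Y q -> ext v' v q ->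
  g' (iota q) (cov nab' X' (cov nab' Y' v') (iota q)) (E' j (iota q)) =
  g q (cov nab X (cov nab Y v) q) (E j q)
  - \sum_l normal_part Y' v' l * normal_part X' (E' j) l.
Proof.
move=> eX eY ev; have [sX' sX _] := eX; have [sY' sY _] := eY; have [sv' sv _] := ev.
have eEj := frame_extension j; have [sE' sE _] := eEj.
have sYv' := cov_smooth hnab' sY' sv'; have sYv := cov_smooth hnab sY sv.
have tX := smooth_field_tangent sX; have tX' := smooth_field_tangent sX'.
have m' := nab_metric hnab' sYv' sE' tX'.
have m := nab_metric hnab sYv sE tX.
have mm : X' (iota q) (fun s => g' s (cov nab' Y' v' s) (F (lshift k j) s)) =
    X q (fun r => g r (cov nab Y v r) (E j r)).
  rewrite (extensionE eX) tangent_mapE; last exact: (ambient_metric_smooth hg').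
  apply: (tangent_near tX).
  apply: filterS3 (field_extension_near hiota eY) (field_extension_near hiota ev)
    (field_extension_near hiota eEj) => r eYr evr eEr.
  exact: (gauss_formula hiota hg' hnab' hnab eYr evr eEr).
have tYv' := cov_tangent hnab' sY' sv'; have tXE' := cov_tangent hnab' sX' sE'.
have tYv := cov_tangent hnab sY sv; have tXE := cov_tangent hnab sX sE.
(* Pythagoras, with the tangential components identified by the Gauss formula. *)
have key : g' (iota q) (cov nab' Y' v' (iota q)) (cov nab' X' (E' j) (iota q)) =
    g q (cov nab Y v q) (cov nab X (E j) q)
    + \sum_l normal_part Y' v' l * normal_part X' (E' j) l.
  rewrite ambient_parseval //; congr (_ + _).
  rewrite (frame_parseval hb hE) //; apply: eq_bigr => i _.
  by rewrite (gauss_formula hiota hg' hnab' hnab eY ev (frame_extension i))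
    (gauss_formula hiota hg' hnab' hnab eX eEj (frame_extension i)).
move: m' m; rewrite mm => ->; rewrite -/(cov nab' X' (E' j) (iota q)) key.
rewrite -/(cov nab' X' (cov nab' Y' v') (iota q)) -/(cov nab X (cov nab Y v) q).
rewrite -/(cov nab X (E j) q).
move: (g' _ (cov nab' X' _ _) _) (g q (cov nab X _ _) _) (g q (cov nab Y v q) _) (\sum_l _).
by move=> a b c d; lra.
Qed.


(** The form b_l(x,E_i), in which x is a single vector; the symmetry of the second
    fundamental form relates it to derivatives in the direction E_i
    ([normal_part_field]). *)
Definition scalar_sff l x i : R :=
  g' (iota q) (nab' (E' i) (iota q) (tm q x)) (N l (iota q)).

Lemma normal_part_frame X' X i l : ext X' X q ->
  normal_part X' (E' i) l = scalar_sff l (X q) i.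
Proof. by move=> /extensionE eX; rewrite /normal_part /cov eX. Qed.

Lemma normal_part_field v' v i l : ext v' v q ->
  normal_part (E' i) v' l = scalar_sff l (v q) i.
Proof.
by move=> ev; rewrite (normal_part_sym l (frame_extension i) ev) (normal_part_frame i l ev).
Qed.

Let nab_frame_tangent x i : tangent q x ->
  tangent (iota q) (nab' (E' i) (iota q) (tm q x)).
Proof. by move=> tx; apply: (nab_tangent hnab') => //; exact: tm_tangent. Qed.

Lemma scalar_sff_sum l (c : 'I_n -> R) i :
  scalar_sff l (\sum_j c j *: E j q) i = \sum_j c j * scalar_sff l (E j q) i.
Proof.
rewrite /scalar_sff tangent_map_sum (nab_sum hnab') //; last first.
  by move=> j; apply: tm_tangent; exact: tangentZ.
rewrite (metric_suml hb') //; last first.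
  by move=> j; apply: nab_frame_tangent; exact: tangentZ.
apply: eq_bigr => j _; rewrite tangent_mapZ (nabZ hnab') //; last exact: tm_tangent.
by rewrite (metricZl hb') //; exact: nab_frame_tangent.
Qed.

Definition normal_field (eta : vfield M') : Prop :=
  \forall r \near q, forall i, g' (iota r) (eta (iota r)) (E' i (iota r)) = 0.

Lemma frame_normal_field l : normal_field (N l).
Proof.
apply: filterS (adapted_frames_near hA) => r hAr i.
by rewrite (frame_orthonormal (adapted_ambient hAr)) eq_sym eq_lrshift.
Qed.

(** The Weingarten equation: differentiate <eta,E_i'> = 0 along M. *)
Lemma metric_nab_normal eta x i : smooth_field eta (iota q) -> normal_field eta ->
  tangent q x ->
  g' (iota q) (nab' eta (iota q) (tm q x)) (E' i (iota q)) =
  - \sum_l g' (iota q) (eta (iota q)) (N l (iota q)) * scalar_sff l x i.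
Proof.
move=> seta neta tx; have ttx := tm_tangent tx.
have sE' := sF (lshift k i).
have := nab_metric hnab' seta sE' ttx.
rewrite tangent_mapE; last exact: (ambient_metric_smooth hg').
rewrite (@tangent_near _ _ _ _ _ tx _ (fun=> 0)); last by apply: filterS neta => r; exact.
rewrite (tangent_cst tx) => /esym/eqP; rewrite addr_eq0 => /eqP ->; congr (- _).
rewrite ambient_parseval; [|exact: smooth_field_tangent|exact: nab_frame_tangent].
rewrite big1 ?add0r // => j _.
by rewrite (nbhs_singleton neta) mul0r.
Qed.

Lemma weingarten_comp eta x : smooth_field eta (iota q) -> normal_field eta ->
  tangent q x ->
  weingarten iota g' nab' eta q x =
  \sum_i (\sum_l g' (iota q) (eta (iota q)) (N l (iota q)) * scalar_sff l x i) *: E i q.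
Proof.
move=> seta neta tx; rewrite /weingarten tproj_comp; last first.
  by apply: (nab_tangent hnab') => //; exact: tm_tangent.
rewrite -sumrN; apply: eq_bigr => i _.
by rewrite metric_nab_normal // scaleNr opprK.
Qed.

Lemma weingarten_frame l x : tangent q x ->
  weingarten iota g' nab' (N l) q x = \sum_i scalar_sff l x i *: E i q.
Proof.
move=> tx; rewrite weingarten_comp //; last exact: frame_normal_field.
apply: eq_bigr => i _; rewrite (bigD1 l) //= (frame_orthonormal hF) eqxx mul1r.
rewrite big1 ?addr0 // => l' /negPf ll.
by rewrite (frame_orthonormal hF) eq_rshift eq_sym ll mul0r.
Qed.

Lemma weingarten_frame2 l x : tangent q x ->
  weingarten iota g' nab' (N l) q (weingarten iota g' nab' (N l) q x) =
  \sum_i (\sum_j scalar_sff l x j * scalar_sff l (E j q) i) *: E i q.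
Proof.
move=> tx; rewrite (weingarten_frame l tx) weingarten_frame; last first.
  exact: (frame_sum_tangent hE).
by apply: eq_bigr => i _; rewrite scalar_sff_sum.
Qed.

(** The bracket [eta,v] is the derivative of v along eta minus that of eta along
    v, and the latter is a Weingarten term as v is tangent to M. *)
Lemma metric_lie_normal eta v' v j : smooth_field eta (iota q) -> normal_field eta ->
  ext v' v q ->
  g' (iota q) (lie eta v' (iota q)) (E' j (iota q)) =
  g' (iota q) (cov nab' eta v' (iota q)) (E' j (iota q)) +
  \sum_l g' (iota q) (eta (iota q)) (N l (iota q)) * scalar_sff l (v q) j.
Proof.
move=> seta neta ev; have [sv' sv _] := ev; have tv := smooth_field_tangent sv.
rewrite (lieE hnab') // (metricBl hb') //; try exact: (cov_tangent hnab').
congr (_ + _); rewrite {1}/cov (extensionE ev) metric_nab_normal //.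
by rewrite opprK.
Qed.

Lemma second_ff_tangent i : tangent (iota q) (second_ff iota g' nab' (E' i) q (E i q)).
Proof. by apply: nproj_tangent => //; exact: nab_frame_tangent. Qed.

Lemma mean_curvature_vector_tangential i :
  g' (iota q) (mean_curvature_vector iota g' nab' E E' q) (E' i (iota q)) = 0.
Proof.
have tII := second_ff_tangent.
rewrite (metricZl hb') //; last exact: tangent_sum.
rewrite (metric_suml hb') // big1 ?mulr0 // => j _.
by rewrite metric_nproj_tangent //; exact: nab_frame_tangent.
Qed.

Section MeanCurvature.
Variable H' : vfield M'.
Hypothesis sH' : smooth_field H' (iota q).
Hypothesis hn : (0 < n)%N.
Hypothesis hH' : \forall r \near q, H' (iota r) = mean_curvature_vector iota g' nab' E E' r.

Lemma mean_curvature_sum :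
  n%:R *: H' (iota q) = \sum_i second_ff iota g' nab' (E' i) q (E i q).
Proof.
rewrite (nbhs_singleton hH') /mean_curvature_vector scalerA mulfV ?scale1r //.
by rewrite pnatr_eq0 -lt0n.
Qed.

Lemma mean_curvature_comp l :
  n%:R * g' (iota q) (H' (iota q)) (N l (iota q)) = \sum_i scalar_sff l (E i q) i.
Proof.
have tH := smooth_field_tangent sH'.
rewrite -(metricZl hb') // mean_curvature_sum (metric_suml hb') //; last first.
  exact: second_ff_tangent.
by apply: eq_bigr => i _; rewrite metric_nproj_normal //; exact: nab_frame_tangent.
Qed.

(** The derivatives of v in the directions D'_(E_i) E_i split into intrinsic
    directions and the normal parts II(E_i,E_i), which add up to n H. *)
Lemma second_cov_tangential v' v j : ext v' v q ->
  \sum_i g' (iota q) (second_cov nab' (E' i) v' (iota q)) (E' j (iota q)) =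
  \sum_i g q (second_cov nab (E i) v q) (E j q)
  - \sum_l \sum_i scalar_sff l (v q) i * scalar_sff l (E i q) j
  - n%:R * g' (iota q) (cov nab' H' v' (iota q)) (E' j (iota q)).
Proof.
move=> ev; have [sv' sv _] := ev.
have tII := second_ff_tangent; have tH := smooth_field_tangent sH'.
have sEi i := frame_smooth hE i.
have -> : n%:R * g' (iota q) (cov nab' H' v' (iota q)) (E' j (iota q)) =
    \sum_i g' (iota q) (nab' v' (iota q) (second_ff iota g' nab' (E' i) q (E i q)))
      (E' j (iota q)).
  rewrite -(metricZl hb') //; last exact: (cov_tangent hnab').
  rewrite -(nabZ hnab') // mean_curvature_sum (nab_sum hnab') // (metric_suml hb') //.
  by move=> i; exact: (nab_tangent hnab').
rewrite exchange_big /= -!sumrB; apply: eq_bigr => i _.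
have ei := frame_extension i.
(* The decomposition D'_(E_i) E_i = D_(E_i) E_i + II(E_i,E_i). *)
have cE : cov nab' (E' i) (E' i) (iota q) =
    tm q (cov nab (E i) (E i) q) + second_ff iota g' nab' (E' i) q (E i q).
  rewrite /second_ff /nproj -(extensionE ei) -/(cov nab' (E' i) (E' i) (iota q)).
  have := tproj_nab ei (tE i); rewrite -(extensionE ei) => e.
  by rewrite {2}/cov e addrC subrK.
have tcE : tangent q (cov nab (E i) (E i) q) by exact: (cov_tangent hnab).
have ttcE := tm_tangent tcE.
rewrite /second_cov.
have sEv' := cov_smooth hnab' (sF (lshift k i)) sv'.
have sEE' := cov_smooth hnab' (sF (lshift k i)) (sF (lshift k i)).
have sEE := cov_smooth hnab (sEi i) (sEi i).
have sEv := cov_smooth hnab (sEi i) sv.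
rewrite (metricBl hb' (cov_tangent hnab' (sF _) sEv') (cov_tangent hnab' sEE' sv') (tF _)).
rewrite (metricBl hb (cov_tangent hnab (sEi i) sEv) (cov_tangent hnab sEE sv) (tE j)).
rewrite (gauss_second j ei ei ev).
rewrite [cov nab' (cov nab' _ _) _ _]/cov cE (nabD hnab') //.
rewrite (metricDl hb') //; try exact: (nab_tangent hnab').
have -> : g' (iota q) (nab' v' (iota q) (tm q (cov nab (E i) (E i) q))) (E' j (iota q)) =
    g q (cov nab (cov nab (E i) (E i)) v q) (E j q).
  by rewrite -metric_tproj ?(tproj_nab ev) //; exact: (nab_tangent hnab').
have -> : \sum_l normal_part (E' i) v' l * normal_part (E' i) (E' j) l =
    \sum_l scalar_sff l (v q) i * scalar_sff l (E i q) j.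
  apply: eq_bigr => l _; rewrite (normal_part_field _ _ ev) ; congr (_ * _).
  exact: (normal_part_frame _ _ ei).
by rewrite opprD !addrA; congr (_ - _); rewrite addrAC.
Qed.

End MeanCurvature.

(** Traced Gauss equation: antisymmetrize [gauss_second] in its two directions. *)
Lemma ricci_tangential v' v j : ext v' v q ->
  ric g' nab' F (E' j) v' (iota q) =
  ric g nab E (E j) v q
  - \sum_l scalar_sff l (v q) j * \sum_i scalar_sff l (E i q) i
  + \sum_l \sum_i scalar_sff l (v q) i * scalar_sff l (E i q) j
  + \sum_l riem g' nab' (N l) (E' j) v' (N l) (iota q).
Proof.
move=> ev; have [sv' sv _] := ev.
have ej := frame_extension j; have [sEj' sEj _] := ej.
rewrite /ric big_split_ord /=; congr (_ + _).
have -> : \sum_l scalar_sff l (v q) j * (\sum_i scalar_sff l (E i q) i) =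
    \sum_i \sum_l scalar_sff l (v q) j * scalar_sff l (E i q) i.
  by rewrite exchange_big; apply: eq_bigr => l _; rewrite mulr_sumr.
rewrite [X in _ = _ - _ + X]exchange_big /= -sumrB -big_split.
apply: eq_bigr => i _ /=.
have ei := frame_extension i; have [sEi' sEi _] := ei.
rewrite (riemE hb' hnab' sEi' sEj' sv' sEi') (riemE hb hnab sEi sEj sv sEi).
rewrite (gauss_second i ei ej ev) (gauss_second i ej ei ev).
have -> : g' (iota q) (cov nab' (lie (E' i) (E' j)) v' (iota q)) (E' i (iota q)) =
    g q (cov nab (lie (E i) (E j)) v q) (E i q).
  rewrite {1}/cov (lie_extension hiota ei ej) -metric_tproj; last first.
    by apply: (nab_tangent hnab') => //; apply: tm_tangent; exact: (lie_tangent hnab).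
  by rewrite (tproj_nab ev) //; exact: (lie_tangent hnab).
have -> : \sum_l normal_part (E' j) v' l * normal_part (E' i) (E' i) l =
    \sum_l scalar_sff l (v q) j * scalar_sff l (E i q) i.
  apply: eq_bigr => l _; rewrite (normal_part_field _ _ ev); congr (_ * _).
  exact: (normal_part_frame _ _ ei).
have -> : \sum_l normal_part (E' i) v' l * normal_part (E' j) (E' i) l =
    \sum_l scalar_sff l (v q) i * scalar_sff l (E i q) j.
  apply: eq_bigr => l _; rewrite (normal_part_field _ _ ev); congr (_ * _).
  rewrite (normal_part_sym l ej ei); exact: (normal_part_frame _ _ ei).
by ring.
Qed.

Lemma div_decomposition v' v : ext v' v q ->
  div g' nab' F v' (iota q) = div g nab E v q + div_perp iota g' nab' N v' q.
Proof.
move=> ev; rewrite /div big_split_ord /=; congr (_ + _).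
apply: eq_bigr => i _; have ei := frame_extension i.
exact: (gauss_formula hiota hg' hnab' hnab ei ev ei).
Qed.

End AtPoint.

Lemma mean_curvature_normal q H' : adapted_frames q ->
  (\forall r \near q, H' (iota r) = mean_curvature_vector iota g' nab' E E' r) ->
  normal_field q H'.
Proof.
move=> hA; apply: filterS2 (adapted_frames_near hA) => r hAr -> i.
exact: mean_curvature_vector_tangential.
Qed.

Lemma derivative_div_decomposition q v' v j : adapted_frames q -> ext v' v q ->
  F (lshift k j) (iota q) (div g' nab' F v') =
  E j q (div g nab E v) + E j q (div_perp iota g' nab' N v').
Proof.
move=> hA ev; have [sv' sv _] := ev.
have hE := adapted_intrinsic hA; have hF := adapted_ambient hA.
have tE := frame_tangent hE j.
have sdiv' := div_smooth hb' hnab' hF sv'; have sdiv := div_smooth hb hnab hE sv.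
have sperp : smooth_at (div_perp iota g' nab' N v') q.
  have sp : smooth_at (fun s => \sum_l g' s (cov nab' (N l) v' s) (N l s)) (iota q).
    apply: smooth_at_sum => l; apply: (ambient_metric_smooth hg').
      exact: (cov_smooth hnab' (frame_smooth hF _) sv').
    exact: (frame_smooth hF).
  exact: (emb_smooth hiota sp).
rewrite (extensionE (frame_extension hA j)) tangent_mapE //.
rewrite -(tangent_addf tE sdiv sperp); apply: (tangent_near tE).
apply: filterS2 (adapted_frames_near hA) (field_extension_near hiota ev) => r hAr evr.
exact: div_decomposition.
Qed.

End Submanifolds.

(** * Tangential parts of the Laplacians *)

Section LinearCombinations.
Variables (R : realType) (m n : nat) (M : manifold R m) (e : 'I_n -> tvec M).
Implicit Types c d : 'I_n -> R.

Definition lincomb c : tvec M := \sum_j c j *: e j.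

Lemma lincombD c d : lincomb c + lincomb d = lincomb (fun j => c j + d j).
Proof. by rewrite /lincomb -big_split; apply: eq_bigr => j _; rewrite scalerDl. Qed.

Lemma lincombN c : - lincomb c = lincomb (fun j => - c j).
Proof. by rewrite /lincomb -sumrN; apply: eq_bigr => j _; rewrite scaleNr. Qed.

Lemma lincombZ a c : a *: lincomb c = lincomb (fun j => a * c j).
Proof. by rewrite /lincomb scaler_sumr; apply: eq_bigr => j _; rewrite scalerA. Qed.

Lemma lincomb_sum k (c : 'I_k -> 'I_n -> R) :
  \sum_l lincomb (c l) = lincomb (fun j => \sum_l c l j).
Proof.
rewrite /lincomb exchange_big; apply: eq_bigr => j _.
by rewrite scaler_suml.
Qed.

Lemma eq_lincomb c d : (forall j, c j = d j) -> lincomb c = lincomb d.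
Proof. by move=> cd; apply: eq_bigr => j _; rewrite cd. Qed.

End LinearCombinations.

Section Projections.
Variables (R : realType) (n k : nat) (M : manifold R n) (M' : manifold R (n + k)).
Variables (iota : M -> M') (hiota : embedding iota).
Variables (g' : metric M') (hg' : riemannian g').
Variables (nab' : connection M') (hnab' : levi_civita g' nab').
Local Notation g := (induced_metric iota g').
Variables (nab : connection M) (hnab : levi_civita g nab).
Variables (E : 'I_n -> vfield M) (F : 'I_(n + k) -> vfield M').
Local Notation E' := (fun i : 'I_n => F (lshift k i)).
Local Notation N := (fun l : 'I_k => F (rshift n l)).
Variables (p : M) (v : vfield M) (v' H' : vfield M').
Hypothesis hn : (0 < n)%N.
Hypothesis hA : adapted_frames iota g' E F p.
Hypothesis ev : field_extension iota v' v p.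
Hypothesis sH' : smooth_field H' (iota p).
Hypothesis hH' : \forall r \near p, H' (iota r) = mean_curvature_vector iota g' nab' E E' r.

Local Notation T := (tproj iota g' p).
Local Notation W eta := (weingarten iota g' nab' eta p).
Local Notation sff := (scalar_sff iota g' nab' F p).
Local Notation comb := (lincomb (fun j => E j p)).

Let hb' : bilinear_metric g' := riemannian_bilinear hg'.
Let hb : bilinear_metric g := induced_bilinear hiota hg'.
Let hE : on_frame g p E := adapted_intrinsic hA.
Let hF : on_frame g' (iota p) F := adapted_ambient hA.
Let sv : smooth_field v p := extended_smooth ev.
Let sv' : smooth_field v' (iota p) := extension_smooth ev.
Let sN l : smooth_field (N l) (iota p) := frame_smooth hF (rshift n l).
Let tv : tangent p (v p) := smooth_field_tangent sv.
Let nH' : normal_field iota g' F p H' := mean_curvature_normal hiota hg' hnab' hA hH'.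

Definition second_trace j := \sum_i g p (second_cov nab (E i) v p) (E j p).
Definition shape_squared j := \sum_l \sum_i sff l (v p) i * sff l (E i p) j.
Definition mean_shape j := \sum_l sff l (v p) j * \sum_i sff l (E i p) i.
Definition mean_derivative j :=
  n%:R * g' (iota p) (cov nab' H' v' (iota p)) (E' j (iota p)).
Definition normal_second_trace j :=
  \sum_l g' (iota p) (second_cov nab' (N l) v' (iota p)) (E' j (iota p)).
Definition normal_curvature j := \sum_l riem g' nab' (N l) (E' j) v' (N l) (iota p).

(** The coefficient common to all the operators: tangential directions by
    [second_cov_tangential], normal ones left as they are. *)
Lemma ambient_second_trace j :
  - \sum_a g' (iota p) (second_cov nab' (F a) v' (iota p)) (E' j (iota p)) =
  - second_trace j + shape_squared j + mean_derivative j - normal_second_trace j.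
Proof.
rewrite big_split_ord /= (second_cov_tangential hiota hg' hnab' hnab hA sH' hn hH' j ev).
by rewrite /second_trace /shape_squared /mean_derivative /normal_second_trace; ring.
Qed.

Lemma tproj_bochner : T (bochner_laplacian nab' F v' (iota p)) = comb (fun j =>
  - second_trace j + shape_squared j + mean_derivative j - normal_second_trace j).
Proof.
rewrite (bochner_laplacian_comp hb' hnab' hF sv') (tproj_frame_sum hiota hg' hA).
by apply: eq_lincomb => j; rewrite ambient_second_trace.
Qed.

Lemma tproj_deformation : T (deformation_laplacian g' nab' F v' (iota p)) = comb (fun j =>
  - second_trace j + shape_squared j + mean_derivative j - normal_second_trace j
  - (E j p (div g nab E v) + E j p (div_perp iota g' nab' N v'))
  - (ric g nab E (E j) v p - mean_shape j + shape_squared j + normal_curvature j)).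
Proof.
rewrite (deformation_laplacian_comp hb' hnab' hF sv') (tproj_frame_sum hiota hg' hA).
apply: eq_lincomb => j; rewrite ambient_second_trace.
rewrite (derivative_div_decomposition hiota hg' hnab' hnab j hA ev).
by rewrite (ricci_tangential hiota hg' hnab' hnab hA j ev).
Qed.

Lemma tproj_bochner_ricci :
  T (bochner_laplacian nab' F v' (iota p) - ricv g' nab' F v' (iota p)) = comb (fun j =>
  - second_trace j + shape_squared j + mean_derivative j - normal_second_trace j
  - (ric g nab E (E j) v p - mean_shape j + shape_squared j + normal_curvature j)).
Proof.
rewrite (bochner_laplacian_comp hb' hnab' hF sv') (ricv_comp hb' hnab' hF sv').
rewrite -sumrB.
under eq_bigr do rewrite -scalerBl.
rewrite (tproj_frame_sum hiota hg' hA).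
apply: eq_lincomb => j; rewrite ambient_second_trace.
by rewrite (ricci_tangential hiota hg' hnab' hnab hA j ev).
Qed.

Lemma tproj_hodge : T (hodge_laplacian g' nab' F v' (iota p)) = comb (fun j =>
  - second_trace j + shape_squared j + mean_derivative j - normal_second_trace j
  + (ric g nab E (E j) v p - mean_shape j + shape_squared j + normal_curvature j)).
Proof.
rewrite (hodge_laplacian_comp hb' hnab' hF sv') (tproj_frame_sum hiota hg' hA).
apply: eq_lincomb => j; rewrite ambient_second_trace.
by rewrite (ricci_tangential hiota hg' hnab' hnab hA j ev).
Qed.

Lemma weingarten_squared_sum : \sum_l W (N l) (W (N l) (v p)) = comb shape_squared.
Proof.
rewrite -lincomb_sum; apply: eq_bigr => l _.
exact: (weingarten_frame2 hiota hg' hnab' hA l tv).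
Qed.

Lemma tproj_cov_mean_curvature :
  n%:R *: T (cov nab' H' v' (iota p)) = comb mean_derivative.
Proof.
rewrite (tproj_comp hiota hg' hA); last exact: (cov_tangent hnab').
exact: lincombZ.
Qed.

Lemma mean_curvature_scale (f : 'I_k -> R) :
  n%:R * \sum_l g' (iota p) (H' (iota p)) (N l (iota p)) * f l =
  \sum_l f l * \sum_i sff l (E i p) i.
Proof.
rewrite mulr_sumr; apply: eq_bigr => l _.
by rewrite mulrA (mean_curvature_comp hiota hg' hnab' hA sH' hn hH') mulrC.
Qed.

Lemma tproj_lie_mean_curvature : n%:R *: T (lie H' v' (iota p)) =
  comb (fun j => mean_derivative j + mean_shape j).
Proof.
rewrite (tproj_comp hiota hg' hA); last exact: (lie_tangent hnab').
rewrite -[\sum_i _]/(comb _) lincombZ; apply: eq_lincomb => j.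
by rewrite (metric_lie_normal hiota hg' hnab' hA j sH' nH' ev) mulrDr mean_curvature_scale.
Qed.

Lemma weingarten_mean_curvature : n%:R *: W H' (v p) = comb mean_shape.
Proof.
rewrite (weingarten_comp hiota hg' hnab' hA sH' nH' tv).
rewrite -[\sum_i _]/(comb _) lincombZ; apply: eq_lincomb => j.
by rewrite mean_curvature_scale.
Qed.

Lemma tproj_second_cov_sum :
  \sum_l T (second_cov nab' (N l) v' (iota p)) = comb normal_second_trace.
Proof.
rewrite -lincomb_sum; apply: eq_bigr => l _.
rewrite (tproj_comp hiota hg' hA) //; exact: (hess_tangent hnab').
Qed.

Lemma normal_curv_sum :
  \sum_l normal_curv iota g' nab' E E' (N l) v' p = comb normal_curvature.
Proof. by rewrite -lincomb_sum. Qed.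

Lemma bochner_comb : bochner_laplacian nab E v p = comb (fun j => - second_trace j).
Proof. exact: (bochner_laplacian_comp hb hnab hE sv). Qed.

Lemma general_codimension :
  [/\ T (bochner_laplacian nab' F v' (iota p)) =
        bochner_laplacian nab E v p
        + \sum_l W (N l) (W (N l) (v p))
        + n%:R *: T (cov nab' H' v' (iota p))
        - \sum_l T (second_cov nab' (N l) v' (iota p)),
      T (deformation_laplacian g' nab' F v' (iota p)) =
        deformation_laplacian g nab E v p
        + n%:R *: T (lie H' v' (iota p))
        - \sum_l T (second_cov nab' (N l) v' (iota p))
        - \sum_l normal_curv iota g' nab' E E' (N l) v' p
        - grad E (div_perp iota g' nab' N v') p,
      T (bochner_laplacian nab' F v' (iota p) - ricv g' nab' F v' (iota p)) =
        bochner_laplacian nab E v p - ricv g nab E v p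
        + n%:R *: T (lie H' v' (iota p))
        - \sum_l T (second_cov nab' (N l) v' (iota p))
        - \sum_l normal_curv iota g' nab' E E' (N l) v' p
    & T (hodge_laplacian g' nab' F v' (iota p)) =
        hodge_laplacian g nab E v p
        + 2 *: \sum_l W (N l) (W (N l) (v p))
        + n%:R *: T (cov nab' H' v' (iota p))
        - n%:R *: W H' (v p)
        - \sum_l T (second_cov nab' (N l) v' (iota p))
        + \sum_l normal_curv iota g' nab' E E' (N l) v' p].
Proof.
rewrite tproj_bochner tproj_deformation tproj_bochner_ricci tproj_hodge.
rewrite weingarten_squared_sum tproj_cov_mean_curvature tproj_lie_mean_curvature.
rewrite weingarten_mean_curvature tproj_second_cov_sum normal_curv_sum bochner_comb.
rewrite (deformation_laplacian_comp hb hnab hE sv) (ricv_comp hb hnab hE sv).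
rewrite (hodge_laplacian_comp hb hnab hE sv) /grad /sharp /d0.
rewrite -![\sum_b _ *: E b p]/(comb _) !(lincombN, lincombZ) !lincombD.
by split; apply: eq_lincomb => j; rewrite /second_trace; ring.
Qed.

(** * Hypersurfaces *)

Section Hypersurface.
Variable l : 'I_k.
Hypothesis hk : forall l', l' = l.
Local Notation H := (mean_curvature iota g' nab' E (N l) p).

Let tN : tangent (iota p) (N l (iota p)) := smooth_field_tangent (sN l).

Lemma sum_normal (V : nmodType) (f : 'I_k -> V) : \sum_l' f l' = f l.
Proof. by apply: big_pred1 => l'; rewrite /= [l']hk eqxx. Qed.

Lemma mean_curvature_scalar : n%:R * H = \sum_i sff l (E i p) i.
Proof.
rewrite /mean_curvature mulrA mulfV ?mul1r ?pnatr_eq0 -?lt0n //.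
apply: eq_bigr => i _; rewrite (weingarten_frame hiota hg' hnab' hA); last first.
  exact: (frame_tangent hE).
by rewrite (frame_comp hb hE).
Qed.

Lemma mean_curvature_hypersurface : H' (iota p) = H *: N l (iota p).
Proof.
have n0 : n%:R != 0 :> R by rewrite pnatr_eq0 -lt0n.
apply: (ambient_ext hg' hA); [exact: smooth_field_tangent|exact: tangentZ|move=> i|move=> l'].
  rewrite (nbhs_singleton nH') (metricZl hb' _ tN); last exact: (frame_tangent hF).
  by rewrite (frame_orthonormal hF) eq_sym eq_lrshift mulr0.
apply: (mulfI n0); rewrite (mean_curvature_comp hiota hg' hnab' hA sH' hn hH').
rewrite (metricZl hb' _ tN); last exact: (frame_tangent hF).
by rewrite [l']hk (frame_orthonormal hF) eqxx mulr1 mean_curvature_scalar.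
Qed.

Lemma tprojZ (a : R) (x : tvec M') : tangent (iota p) x -> T (a *: x) = a *: T x.
Proof.
move=> tx; rewrite !(tproj_comp hiota hg' hA) //; last exact: tangentZ.
rewrite scaler_sumr; apply: eq_bigr => i _.
by rewrite (metricZl hb') // ?scalerA //; exact: (frame_tangent hF).
Qed.

Lemma tprojB (x y : tvec M') : tangent (iota p) x -> tangent (iota p) y ->
  T (x - y) = T x - T y.
Proof.
move=> tx ty; rewrite !(tproj_comp hiota hg' hA) //; last exact: tangentB.
rewrite -sumrB; apply: eq_bigr => i _.
by rewrite (metricBl hb') // ?scalerBl //; exact: (frame_tangent hF).
Qed.

Lemma cov_mean_hypersurface : n%:R *: T (cov nab' H' v' (iota p)) =
  (n%:R * H) *: T (cov nab' (N l) v' (iota p)).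
Proof.
rewrite {1}/cov mean_curvature_hypersurface (nabZ hnab' _ sv' tN) tprojZ ?scalerA //.
exact: (nab_tangent hnab').
Qed.

Lemma weingarten_mean_hypersurface :
  n%:R *: W H' (v p) = (n%:R * H) *: W (N l) (v p).
Proof.
rewrite weingarten_mean_curvature (weingarten_frame hiota hg' hnab' hA l tv).
rewrite -[\sum_i _]/(comb _) lincombZ; apply: eq_lincomb => j.
by rewrite /mean_shape sum_normal mean_curvature_scalar mulrC.
Qed.

Lemma lie_normal_field eta : smooth_field eta (iota p) -> normal_field iota g' F p eta ->
  T (lie eta v' (iota p)) = T (cov nab' eta v' (iota p)) + W eta (v p).
Proof.
move=> seta neta; rewrite (lieE hnab') // tprojB; try exact: (cov_tangent hnab').
by rewrite {2}/cov (extensionE ev).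
Qed.

Lemma lie_mean_hypersurface :
  n%:R *: T (lie H' v' (iota p)) = (n%:R * H) *: T (lie (N l) v' (iota p)).
Proof.
rewrite !lie_normal_field //; last exact: (frame_normal_field hiota hA).
by rewrite !scalerDr cov_mean_hypersurface weingarten_mean_hypersurface.
Qed.

Lemma unit_normal_derivative (x : tvec M') : tangent (iota p) x ->
  g' (iota p) (nab' (N l) (iota p) x) (N l (iota p)) = 0.
Proof.
move=> tx; have := frame_connection_antisym hb' hnab' hF (rshift n l) (rshift n l) tx.
by move=> e; lra.
Qed.

(** D'_N N is orthogonal to the unit normal N, hence tangent to M, and the Gauss
    formula applies to the derivative of v in its direction. *)
Lemma second_cov_hypersurface : T (second_cov nab' (N l) v' (iota p)) =
  T (cov nab' (N l) (cov nab' (N l) v') (iota p))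
  - nab v p (T (cov nab' (N l) (N l) (iota p))).
Proof.
have tNN : tangent (iota p) (cov nab' (N l) (N l) (iota p)) by exact: (cov_tangent hnab').
have sNv := cov_smooth hnab' (sN l) sv'; have sNN := cov_smooth hnab' (sN l) (sN l).
rewrite tprojB; try exact: (cov_tangent hnab').
congr (_ - _); rewrite -(tproj_nab hiota hg' hnab' hnab hA ev); last first.
  exact: (tproj_tangent hiota hg' hA).
rewrite (tangent_of_normal_zero hiota hg' hA tNN) // => l'.
by rewrite [l']hk; exact: unit_normal_derivative.
Qed.

(** The normal component of [N,v] is <D'_N v, N> = div_perp v, which is the
    difference of the two divergences. *)
Lemma lie_normal_tangent :
  div g' nab' F v' (iota p) = 0 -> div g nab E v p = 0 ->
  tangent_map iota p (T (lie (N l) v' (iota p))) = lie (N l) v' (iota p).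
Proof.
move=> dv' dv; have tL := lie_tangent hnab' (sN l) sv'.
apply: (tangent_of_normal_zero hiota hg' hA tL) => l'; rewrite [l']hk.
rewrite (lieE hnab') // (metricBl hb') //; try exact: (cov_tangent hnab').
rewrite [X in _ - X]unit_normal_derivative ?subr0; last exact: smooth_field_tangent.
have := div_decomposition hiota hg' hnab' hnab hA ev.
by rewrite dv' dv add0r /div_perp sum_normal => <-.
Qed.

End Hypersurface.
End Projections.

(* Primed objects live on the ambient manifold. All conclusions are equations
   in T_p M, except the hypersurface formula of the divergence free case, where
   [N, v] is not projected and the equation is in T_(iota p) M'.
   In the deformation formulas the gradient of div_perp has a minus sign:
   for the flat ambient metric, the hyperplane y = 0 and v' = (x1 y) d/dy, the
   left-hand side is - d/dx1 and div_perp is x1. *)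
Theorem corollary1p21 (R : realType) (n k : nat) (hn : (2 <= n)%N) (hk : (1 <= k)%N)
  (M : manifold R n) (M' : manifold R (n + k))
  (iota : M -> M') (hiota : embedding iota)
  (g' : metric M') (hg' : riemannian g')
  (nab' : connection M') (hnab' : levi_civita g' nab')
  (nab : connection M) (hnab : levi_civita (induced_metric iota g') nab)
  (p : M)
  (* adapted orthonormal frames *)
  (E : 'I_n -> vfield M) (hE : on_frame (induced_metric iota g') p E)
  (F : 'I_(n + k) -> vfield M') (hF : on_frame g' (iota p) F)
  (hEF : \forall q \near p, forall i : 'I_n,
     F (lshift k i) (iota q) = tangent_map iota q (E i q))
  (* the vector field and its extension *)
  (v : vfield M) (hv : forall q, smooth_vf v q)
  (v' : vfield M') (hv' : smooth_vf v' (iota p))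
  (hvv' : \forall q \near p, v' (iota q) = tangent_map iota q (v q))
  (* an extension of the mean curvature vector *)
  (H' : vfield M') (hH' : smooth_vf H' (iota p))
  (hHH' : \forall q \near p, H' (iota q) =
     mean_curvature_vector iota g' nab' E (fun i => F (lshift k i)) q) :
  let g := induced_metric iota g' in
  let E' := fun i : 'I_n => F (lshift k i) in
  let Nl := fun l : 'I_k => F (rshift n l) in
  let T := fun x : tvec M' => tproj iota g' p x in
  let W := fun (eta : vfield M') (x : tvec M) => weingarten iota g' nab' eta p x in
  let L := deformation_laplacian g nab E in
  let L' := deformation_laplacian g' nab' F in
  let divergence_free :=
    (\forall x \near iota p, div g' nab' F v' x = 0) /\
    (\forall q \near p, div g nab E v q = 0) in
  [/\
    (* Bochner Laplacian *)
    T (bochner_laplacian nab' F v' (iota p)) =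
      bochner_laplacian nab E v p
      + \sum_l W (Nl l) (W (Nl l) (v p))
      + n%:R *: T (cov nab' H' v' (iota p))
      - \sum_l T (second_cov nab' (Nl l) v' (iota p)),
    (* deformation Laplacian *)
    T (L' v' (iota p)) =
      L v p
      + n%:R *: T (lie H' v' (iota p))
      - \sum_l T (second_cov nab' (Nl l) v' (iota p))
      - \sum_l normal_curv iota g' nab' E E' (Nl l) v' p
      - grad E (div_perp iota g' nab' Nl v') p,
    (* divergence free case *)
    divergence_free ->
    T (bochner_laplacian nab' F v' (iota p) - ricv g' nab' F v' (iota p)) =
      bochner_laplacian nab E v p - ricv g nab E v p
      + n%:R *: T (lie H' v' (iota p))
      - \sum_l T (second_cov nab' (Nl l) v' (iota p))
      - \sum_l normal_curv iota g' nab' E E' (Nl l) v' p,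
    (* Hodge Laplacian *)
    T (hodge_laplacian g' nab' F v' (iota p)) =
      hodge_laplacian g nab E v p
      + 2 *: \sum_l W (Nl l) (W (Nl l) (v p))
      + n%:R *: T (cov nab' H' v' (iota p))
      - n%:R *: W H' (v p)
      - \sum_l T (second_cov nab' (Nl l) v' (iota p))
      + \sum_l normal_curv iota g' nab' E E' (Nl l) v' p
    (* hypersurfaces; l is the only element of 'I_1 *)
  & k = 1%N -> forall l : 'I_k,
    let N := Nl l in
    let s := W N in
    let H := mean_curvature iota g' nab' E N p in
    let NNv := cov nab' N (cov nab' N v') (iota p) in
    let NN := T (cov nab' N N (iota p)) in
    let RN := normal_curv iota g' nab' E E' N v' p in
    (forall i, exists lam : R, s (E i p) = lam *: E i p) ->
    [/\
      T (bochner_laplacian nab' F v' (iota p)) =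
        bochner_laplacian nab E v p
        + s (s (v p))
        + (n%:R * H) *: T (cov nab' N v' (iota p))
        - T NNv + nab v p NN,
      T (L' v' (iota p)) =
        L v p
        + (n%:R * H) *: T (lie N v' (iota p))
        - T NNv + nab v p NN
        - RN
        - grad E (div_perp iota g' nab' Nl v') p,
      divergence_free ->
      tangent_map iota p
        (T (bochner_laplacian nab' F v' (iota p) - ricv g' nab' F v' (iota p))) =
        tangent_map iota p (bochner_laplacian nab E v p - ricv g nab E v p)
        + (n%:R * H) *: lie N v' (iota p)
        + tangent_map iota p (- T NNv + nab v p NN - RN)
    & T (hodge_laplacian g' nab' F v' (iota p)) =
        hodge_laplacian g nab E v p
        + 2 *: s (s (v p))
        + (n%:R * H) *: T (cov nab' N v' (iota p))
        - (n%:R * H) *: s (v p)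
        - T NNv + nab v p NN
        + RN]].
Proof.
have n0 : (0 < n)%N by exact: leq_trans hn.
have sH' : smooth_field H' (iota p) by split.
have hA : adapted_frames iota g' E F p by split.
have ev : field_extension iota v' v p by split; [split|split; exact: hv|].
move=> g E' Nl T W L L' divergence_free.
have [fB fD fR fH] := general_codimension hiota hg' hnab' hnab n0 hA ev sH' hHH'.
split=> //; move=> k1 l N s H NNv NN RN _.
have hk1 (l' : 'I_k) : l' = l.
  have lt0 (i : 'I_k) : i = 0%N :> nat by case: i => i /=; rewrite k1; case: i.
  by apply: val_inj; rewrite /= !lt0.
have eN (V : nmodType) := @sum_normal k l hk1 V.
have e1 := cov_mean_hypersurface hiota hg' hnab' n0 hA ev sH' hHH' hk1.
have e2 := lie_mean_hypersurface hiota hg' hnab' n0 hA ev sH' hHH' hk1.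
have e3 := weingarten_mean_hypersurface hiota hg' hnab' n0 hA ev sH' hHH' hk1.
have e4 := second_cov_hypersurface hiota hg' hnab' hnab hA ev hk1.
have e5 (x y z : tvec M) : x - (y - z) = x - y + z by rewrite opprB addrA addrAC.
rewrite !eN e1 e4 e5 in fB; rewrite !eN e2 e4 e5 in fD.
rewrite !eN e2 e4 e5 in fR; rewrite !eN e1 e3 e4 e5 in fH.
split; [exact: fB|exact: fD| |exact: fH].
move=> [/nbhs_singleton div0' /nbhs_singleton div0].
have eL := lie_normal_tangent hiota hg' hnab' hnab hA ev hk1 div0' div0.
have -> : T (bochner_laplacian nab' F v' (iota p) - ricv g' nab' F v' (iota p)) =
    (bochner_laplacian nab E v p - ricv g nab E v p)
    + (n%:R * H) *: T (lie N v' (iota p)) + (- T NNv + nab v p NN - RN).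
  by rewrite [LHS]fR !addrA.
by rewrite 2!tangent_mapD tangent_mapZ eL.
Qed.
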